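(* For every $C<1$ there exists $b_0>0$ such that for every $b>b_0$, the mixing time and the relaxation time of the heat-bath Glauber dynamics for proper $k$-colorings of the star graph $G^*$ with $k=Cb/\ln b$ colors are $O(b^{1/C}\ln^2 b)$. When $C=1$ (i.e. $k=b/\ln b$), the mixing and relaxation times are $O(b\ln^4 b)$ (for $b$ sufficiently large).
   Context: $G^*$ is the star graph on $b+1$ vertices: a root $r$ adjacent to $b$ leaves $\ell_1,\dots,\ell_b$ (the complete tree of height 1). A proper $k$-coloring assigns colors from $\{1,\dots,k\}$ so adjacent vertices get distinct colors. The heat-bath Glauber dynamics picks a uniformly random vertex and recolors it uniformly among colors not used by its neighbors. Mixing time: $\min\{t:\max_\sigma\|P^t(\sigma,\cdot)-\pi\|_{TV}\le 1/(2e)\}$ with $\pi$ uniform on proper colorings; relaxation time: $1/(1-\lambda)$ with $\lambda$ the second largest eigenvalue in absolute value of the transition matrix. *)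

(* Defs.v *)
From HB Require Import structures.
From mathcomp Require Import all_boot all_order all_algebra.
From mathcomp Require Import all_classical all_reals all_analysis.
From mathcomp Require Import complex.
Set Implicit Arguments. Unset Strict Implicit. Unset Printing Implicit Defensive.
Import Order.TTheory GRing.Theory Num.Theory.
Local Open Scope ring_scope.
Local Open Scope classical_set_scope.

Definition star_adj (b : nat) (u v : 'I_b.+1) : bool :=
  (u != v) && ((val u == 0%N) || (val v == 0%N)).

Definition proper_col (b k : nat) (f : {ffun 'I_b.+1 -> 'I_k}) : bool :=
  [forall u, forall v, star_adj u v ==> (f u != f v)].

Definition coloring (b k : nat) := {f : {ffun 'I_b.+1 -> 'I_k} | proper_col f}.

Definition allowed (b k : nat) (f : {ffun 'I_b.+1 -> 'I_k}) (v : 'I_b.+1)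
  (c : 'I_k) : bool := [forall u, star_adj v u ==> (f u != c)].

Definition nallowed (b k : nat) (f : {ffun 'I_b.+1 -> 'I_k}) (v : 'I_b.+1) : nat :=
  #|[pred c | allowed f v c]|.

(* heat-bath Glauber transition probability f -> g: pick a uniform vertex v,
   recolor it uniformly among the colors not used by its neighbours *)
Definition glauber_trans (R : realType) (b k : nat)
  (f g : {ffun 'I_b.+1 -> 'I_k}) : R :=
  (b.+1)%:R^-1 * \sum_(v : 'I_b.+1)
     (if [forall u, (u != v) ==> (f u == g u)] && allowed f v (g v)
      then (nallowed f v)%:R^-1 else 0).

Definition glauber (R : realType) (b k : nat) : 'M[R]_(#|{: coloring b k}|) :=
  \matrix_(i, j) glauber_trans R (val (enum_val i)) (val (enum_val j)).

Definition tv_from (R : realType) (n : nat) (P : 'M[R]_n) (t : nat) (i : 'I_n) : R :=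
  2^-1 * \sum_(j < n) `|(P ^+ t) i j - n%:R^-1|.   (* pi = uniform *)

Definition mixed_at (R : realType) (n : nat) (P : 'M[R]_n) (t : nat) : Prop :=
  forall i : 'I_n, tv_from P t i <= (2 * expR 1)^-1.

(* t_mix = min { t | max_sigma ||P^t(sigma,.) - pi||_TV <= 1/(2e) } (+oo if none) *)
Definition tmix (R : realType) (n : nat) (P : 'M[R]_n) : \bar R :=
  ereal_inf [set ((t%:R : R)%:E) | t in [set t | mixed_at P t]].

Definition cmod (R : realType) (z : R[i]) : R :=
  Num.sqrt (complex.Re z ^+ 2 + complex.Im z ^+ 2).

Definition cchar (R : realType) (n : nat) (P : 'M[R]_n) : {poly R[i]} :=
  char_poly (map_mx (fun x : R => (x%:C)%C) P).

(* lambda = second largest eigenvalue in absolute value (counted with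
   multiplicity; the largest one being the eigenvalue 1 of the stochastic
   matrix): if 1 is a multiple eigenvalue, lambda = 1; otherwise lambda is the
   largest modulus of an eigenvalue different from 1. *)
Definition slem (R : realType) (n : nat) (P : 'M[R]_n) : R :=
  if (1 < mup 1 (cchar P))%N then 1
  else sup [set cmod mu | mu in [set mu : R[i] | root (cchar P) mu /\ mu != 1]].

Definition trel (R : realType) (n : nat) (P : 'M[R]_n) : \bar R :=
  if slem P < 1 then ((1 - slem P)^-1)%:E else +oo%E.

(* Main.v *)
Require Import Defs.
From HB Require Import structures.
From mathcomp Require Import all_boot all_order all_algebra.
From mathcomp Require Import all_classical all_reals all_analysis.
From mathcomp Require Import complex.
From mathcomp Require Import ring lra zify.
Set Implicit Arguments. Unset Strict Implicit. Unset Printing Implicit Defensive.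
Import Order.TTheory GRing.Theory Num.Theory.
Local Open Scope ring_scope.

(* Write [K_v] for the heat-bath update at [v], so that the chain is
   [P = (b+1)^-1 sum_v K_v], an average of orthogonal projections of [L^2(pi)].

   Spectral gap. Applying all leaf updates to [u] gives a function [g] of the root
   colour only, with [|u - g|^2 <= sum_leaves |u - K_v u|^2]. For functions of the
   root colour the root update alone has gap at least [q k / 3], where
   [q = (1 - 1/(k-1))^b] is the probability that a given colour is missing from the
   leaves: conditionally on two colours being available to the root, at most three
   are on average. As [1 - K_0] is a contraction,
   [|g - K_0 g| <= |u - K_0 u| + |u - g|], so [P] has gap at least
   [c q k / b], that is, relaxation time [O(b^(1/C) ln b)].

   Mixing. Once every leaf has been updated, each colouring has probability at most
   [(k-1)^-b = k pi], whatever the root did meanwhile; this fails with probability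
   at most [1/b] after [2 (b+1) ln b] steps. From a distribution of density at most
   [k], the spectral gap mixes within [O(ln b)] relaxation times. *)

(** * Averages of orthogonal projections *)

Section DotProduct.
Context (R : realFieldType) (n : nat).
Implicit Types (u v w : 'cV[R]_n) (A K P : 'M[R]_n).

(** The stationary law is uniform, so up to the factor [n] this is the inner product of [L^2(pi)],
    and reversibility becomes symmetry of the matrix. *)
Definition dot u v : R := (u^T *m v) 0 0.

Lemma dotE u v : dot u v = \sum_i u i 0 * v i 0.
Proof. by rewrite /dot mxE; apply: eq_bigr => i _; rewrite mxE. Qed.

Lemma dotC u v : dot u v = dot v u.
Proof. by rewrite !dotE; apply: eq_bigr => i _; rewrite mulrC. Qed.

Lemma dotDr u v w : dot u (v + w) = dot u v + dot u w.
Proof. by rewrite /dot mulmxDr mxE. Qed.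

Lemma dotNr u v : dot u (- v) = - dot u v.
Proof. by rewrite /dot mulmxN mxE. Qed.

Lemma dotBr u v w : dot u (v - w) = dot u v - dot u w.
Proof. by rewrite dotDr dotNr. Qed.

Lemma dotZr a u v : dot u (a *: v) = a * dot u v.
Proof. by rewrite /dot -scalemxAr mxE. Qed.

Lemma dotBl u v w : dot (v - w) u = dot v u - dot w u.
Proof. by rewrite !(dotC _ u) dotBr. Qed.

Lemma dotDl u v w : dot (v + w) u = dot v u + dot w u.
Proof. by rewrite !(dotC _ u) dotDr. Qed.

Lemma dotZl a u v : dot (a *: v) u = a * dot v u.
Proof. by rewrite !(dotC _ u) dotZr. Qed.

Lemma dot_sumr (I : finType) u (F : I -> 'cV_n) :
  dot u (\sum_i F i) = \sum_i dot u (F i).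
Proof. by rewrite /dot mulmx_sumr summxE. Qed.

Lemma dot_mulmx A u v : dot (A *m u) v = dot u (A^T *m v).
Proof. by rewrite /dot trmx_mul mulmxA. Qed.

Lemma dotuu_ge0 u : 0 <= dot u u.
Proof. by rewrite dotE sumr_ge0 // => i _; rewrite -expr2 sqr_ge0. Qed.

Lemma dotuu_eq0 u : dot u u = 0 -> u = 0.
Proof.
rewrite dotE => /eqP; rewrite psumr_eq0; last by move=> i _; rewrite -expr2 sqr_ge0.
move=> /allP u0; apply/matrixP => i j; rewrite ord1 mxE.
by have /eqP := u0 i (mem_index_enum i); rewrite -expr2 => /eqP; rewrite sqrf_eq0 => /eqP.
Qed.

Lemma dot_add_sqr_le u v : dot (u + v) (u + v) <= 2 * dot u u + 2 * dot v v.
Proof.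
rewrite !dotE !mulr_sumr -big_split ler_sum // => i _ /=; rewrite mxE.
rewrite -subr_ge0 (_ : _ - _ = (u i 0 - v i 0) ^+ 2) ?sqr_ge0 //; ring.
Qed.

Definition orth_proj K := K^T = K /\ K *m K = K.

Lemma orth_proj_dot K u v : orth_proj K -> dot (K *m u) (K *m v) = dot u (K *m v).
Proof. by move=> [sK iK]; rewrite dot_mulmx sK mulmxA iK. Qed.

Lemma orth_proj_compl K u : orth_proj K ->
  dot (u - K *m u) (u - K *m u) = dot u u - dot u (K *m u).
Proof.
move=> pK; rewrite dotBl !dotBr orth_proj_dot // (dotC (K *m u)); ring.
Qed.

Lemma orth_proj_contr K u : orth_proj K -> dot (K *m u) (K *m u) <= dot u u.
Proof.
move=> pK; have := dotuu_ge0 (u - K *m u).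
by rewrite orth_proj_compl // orth_proj_dot // subr_ge0.
Qed.

Lemma orth_proj_compl_contr K u : orth_proj K ->
  dot (u - K *m u) (u - K *m u) <= dot u u.
Proof.
move=> pK; rewrite orth_proj_compl // -orth_proj_dot //.
by rewrite lerBlDr lerDl dotuu_ge0.
Qed.

(* [u - K w = (u - K u) + K (u - w)] is an orthogonal decomposition. *)
Lemma orth_proj_dist K u w : orth_proj K ->
  dot (u - K *m w) (u - K *m w) <=
  dot (u - K *m u) (u - K *m u) + dot (u - w) (u - w).
Proof.
move=> pK; rewrite -lerBlDl; apply: le_trans (orth_proj_contr (u - w) pK).
have symK : dot w (K *m u) = dot u (K *m w).
  by rewrite dotC dot_mulmx; case: pK => ->.
rewrite orth_proj_compl // mulmxBr !dotBl !dotBr (dotC (K *m w) u).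
rewrite !orth_proj_dot // symK; lra.
Qed.

(** [orth_proj_dist], with the tail of the fold as [w], is applied once per index: each factor costs
    only its own energy, and the squared distances add up with constant 1. *)
Lemma orth_proj_foldr (I : Type) (K : I -> 'M[R]_n) (s : seq I) u :
  (forall i, orth_proj (K i)) ->
  dot (u - foldr (fun i w => K i *m w) u s) (u - foldr (fun i w => K i *m w) u s)
  <= \sum_(i <- s) dot (u - K i *m u) (u - K i *m u).
Proof.
move=> pK; elim: s => [|i s IH] /=; first by rewrite big_nil subrr dotE big1 // => i _; rewrite !mxE mul0r.
rewrite big_cons; apply: le_trans (orth_proj_dist _ _ (pK i)) _.
by rewrite lerD2l.
Qed.

(** Vanishing of this sum is orthogonality to the constants, the subspace on which the gap is
    measured. *)
Definition coord_sum u : R := \sum_i u i 0.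

Lemma dot_const a u : dot (const_mx a) u = a * coord_sum u.
Proof. by rewrite dotE mulr_sumr; apply: eq_bigr => i _; rewrite mxE. Qed.

Lemma coord_sum_mulmx P u : P^T = P -> P *m const_mx 1 = (const_mx 1 : 'cV_n) ->
  coord_sum (P *m u) = coord_sum u.
Proof.
move=> sP P1; have := dot_mulmx P (const_mx 1) u.
by rewrite sP P1 !dot_const !mul1r => <-.
Qed.

(* The proof uses [lam P (lam - P) = P (lam - P) P + (lam - P) P (lam - P)], a sum
   of two nonnegative operators. *)
Lemma psd_contraction P lam u :
  P^T = P -> (forall w, 0 <= dot w (P *m w)) -> 0 < lam ->
  (forall w, coord_sum w = 0 -> dot w (P *m w) <= lam * dot w w) ->
  coord_sum u = 0 -> coord_sum (P *m u) = 0 ->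
  dot (P *m u) (P *m u) <= lam ^+ 2 * dot u u.
Proof.
move=> sP P_ge0 lam_gt0 gap u0 Pu0.
have := P_ge0 (lam *: u - P *m u); rewrite mulmxBr -scalemxAr !dotBl !dotBr.
rewrite !dotZl !dotZr [dot u (P *m (P *m u))](_ : _ = dot (P *m u) (P *m u)); last by rewrite dot_mulmx sP.
have := gap _ u0; have := gap _ Pu0; rewrite (dotC (P *m u) (P *m (P *m u))).
rewrite [dot (P *m (P *m u)) _]dotC.
set a := dot u (P *m u); set c := dot u u; set d := dot (P *m u) (P *m u).
set e := dot _ (P *m (P *m u)) => h1 h2 h3.
(* [h3] is [0 <= lam^2 a - 2 lam d + e] and [h1] is [e <= lam d]; together they give
   [lam d <= lam^2 a], and [h2] bounds [a] by [lam c]. *)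
rewrite -(ler_pM2l lam_gt0); have : lam ^+ 2 * a <= lam ^+ 2 * (lam * c).
  by rewrite ler_wpM2l ?sqr_ge0.
move: h1 h3; rewrite !expr2; lra.
Qed.

Lemma contraction_iter P lam t u :
  P^T = P -> P *m const_mx 1 = (const_mx 1 : 'cV_n) ->
  (forall w, coord_sum w = 0 -> dot (P *m w) (P *m w) <= lam ^+ 2 * dot w w) ->
  coord_sum u = 0 ->
  dot (P ^+ t *m u) (P ^+ t *m u) <= (lam ^+ t) ^+ 2 * dot u u /\
  coord_sum (P ^+ t *m u) = 0.
Proof.
move=> sP P1 contr u0; elim: t => [|t [IH IH0]].
  by rewrite !expr0 !expr1n mul1r mul1mx.
rewrite exprS -mulmxE -mulmxA; split; last by rewrite coord_sum_mulmx.
apply: le_trans (contr _ IH0) _.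
by rewrite [lam ^+ t.+1]exprS exprMn -[leRHS]mulrA ler_wpM2l ?sqr_ge0.
Qed.

(** Sum [2 |u_i| |u_j| <= u_i^2 + u_j^2] over all pairs: the right-hand sides total [2 n |u|^2]. *)
Lemma cauchy_schwarz_l1 u : (\sum_i `|u i 0|) ^+ 2 <= n%:R * dot u u.
Proof.
have dE : dot u u = \sum_i u i 0 ^+ 2.
  by rewrite dotE; apply: eq_bigr => i _; rewrite expr2.
have -> : n%:R * dot u u = 2^-1 * \sum_i \sum_j (u i 0 ^+ 2 + u j 0 ^+ 2).
  under eq_bigr => i _ do rewrite big_split /= sumr_const card_ord -dE.
  rewrite big_split /= sumr_const card_ord sumrMnl -dE -mulr_natl; lra.
rewrite expr2 mulr_suml; under eq_bigr => i _ do rewrite mulr_sumr.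
rewrite ler_pdivlMl // mulr_sumr ler_sum // => i _.
rewrite mulr_sumr ler_sum // => j _.
rewrite -(real_normK (num_real (u i 0))) -(real_normK (num_real (u j 0))).
rewrite -subr_ge0 (_ : _ - _ = (`|u i 0| - `|u j 0|) ^+ 2) ?sqr_ge0 //; ring.
Qed.

End DotProduct.

Section AverageOfProjections.
Context (R : realFieldType) (n : nat) (I : finType) (K : I -> 'M[R]_n).
Hypothesis I_gt0 : (0 < #|I|)%N.
Hypothesis projK : forall i, orth_proj (K i).

Let P := (#|I|%:R)^-1 *: \sum_i K i.

Lemma avg_proj_sym : P^T = P.
Proof. by rewrite /P linearZ /= raddf_sum; congr (_ *: _); apply: eq_bigr => i _; case: (projK i). Qed.

Lemma avg_proj_dot u : dot u (P *m u) = (#|I|%:R)^-1 * \sum_i dot (K i *m u) (K i *m u).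
Proof.
rewrite /P -scalemxAl dotZr mulmx_suml dot_sumr; congr (_ * _).
by apply: eq_bigr => i _; rewrite orth_proj_dot.
Qed.

(** No eigenvalue is negative, so an upper bound on the spectrum off the constants also bounds it in
    absolute value; [psd_contraction] relies on this. *)
Lemma avg_proj_psd u : 0 <= dot u (P *m u).
Proof.
by rewrite avg_proj_dot mulr_ge0 ?invr_ge0 ?ler0n ?sumr_ge0 // => i _; apply: dotuu_ge0.
Qed.

(** Since [|u - K_i u|^2 = <u, u> - <u, K_i u>], the energies sum to [#|I|] times the Dirichlet form
    of [P]; a Poincare constant [T] becomes a gap [1 / (T #|I|)]. *)
Lemma avg_proj_gap T u : 0 < T ->
  dot u u <= T * \sum_i dot (u - K i *m u) (u - K i *m u) ->
  dot u (P *m u) <= (1 - (T * #|I|%:R)^-1) * dot u u.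
Proof.
move=> T_gt0; have I_neq0 : #|I|%:R != 0 :> R by rewrite pnatr_eq0 -lt0n.
have -> : \sum_i dot (u - K i *m u) (u - K i *m u) =
          #|I|%:R * (dot u u - dot u (P *m u)).
  rewrite mulrBr avg_proj_dot mulrA mulfV // mul1r mulr_natl -sumr_const -sumrB.
  by apply: eq_bigr => i _; rewrite orth_proj_compl // orth_proj_dot.
have TI_gt0 : 0 < T * #|I|%:R by rewrite mulr_gt0 // ltr0n.
rewrite mulrA -ler_pdivrMl // mulrBl mul1r; lra.
Qed.

End AverageOfProjections.

(** * Heat-bath updates on the star *)

Section StarColorings.
Context (b k : nat).
Implicit Types (x y : {ffun 'I_b.+1 -> 'I_k}) (u v : 'I_b.+1) (c : 'I_k).

Definition agree_off v x y := [forall u, (u != v) ==> (x u == y u)].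

Definition recolor x v c : {ffun 'I_b.+1 -> 'I_k} :=
  [ffun u => if u == v then c else x u].

Lemma agree_offP v x y :
  reflect (forall u, u != v -> x u = y u) (agree_off v x y).
Proof.
apply: (iffP forallP) => [h u uv|h u]; first by apply/eqP; have := h u; rewrite uv.
by apply/implyP => /h ->.
Qed.

Lemma agree_offC v x y : agree_off v x y = agree_off v y x.
Proof. by apply/agree_offP/agree_offP => h u /h. Qed.

Lemma star_adjC u v : star_adj u v = star_adj v u.
Proof. by rewrite /star_adj eq_sym orbC. Qed.

Lemma star_adj0 u : star_adj ord0 u = (u != ord0).
Proof. by rewrite /star_adj eq_sym andbT. Qed.

Lemma star_adj_leaf v u : v != ord0 -> star_adj v u = (u == ord0).
Proof.
rewrite /star_adj => v0; rewrite (_ : (val v == 0%N) = false) /=; last first.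
  by apply: contraNF v0 => /eqP h; apply/eqP/val_inj.
rewrite (_ : (val u == 0%N) = (u == ord0)) //.
by case: (altP (u =P ord0)) => [->|]; rewrite ?v0 ?andbF.
Qed.

Lemma allowed_leaf x v c : v != ord0 -> allowed x v c = (c != x ord0).
Proof.
move=> v0; apply/forallP/idP => [/(_ ord0)|h u].
  by rewrite star_adj_leaf //= eq_sym.
by rewrite star_adj_leaf //; apply/implyP => /eqP ->; rewrite eq_sym.
Qed.

Lemma allowed_rootP x c :
  reflect (forall u, u != ord0 -> x u != c) (allowed x ord0 c).
Proof.
apply: (iffP forallP) => h u; first by have := h u; rewrite star_adj0 => /implyP.
by rewrite star_adj0; apply/implyP/h.
Qed.

Lemma proper_colP x : reflect (forall u, u != ord0 -> x u != x ord0) (proper_col x).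
Proof.
apply: (iffP forallP) => [h u u0|h u].
  by have /forallP/(_ ord0) := h u; rewrite star_adjC star_adj0 u0.
apply/forallP => v; apply/implyP; have [->|u0] := eqVneq u ord0.
  by rewrite star_adj0 [x _ == _]eq_sym; apply: h.
by rewrite star_adj_leaf // => /eqP ->; apply: h.
Qed.

Lemma allowed_agree_off v x y c : agree_off v x y -> allowed x v c = allowed y v c.
Proof.
move=> /agree_offP xy; apply: eq_forallb => u.
by case: (boolP (star_adj v u)) => //= /andP[vu _]; rewrite xy // eq_sym.
Qed.

Lemma nallowed_agree_off v x y : agree_off v x y -> nallowed x v = nallowed y v.
Proof. by move=> xy; apply: eq_card => c; rewrite !inE (allowed_agree_off _ xy). Qed.

Lemma proper_col_allowed x v : proper_col x -> allowed x v (x v).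
Proof.
by move=> /forallP px; apply/forallP => u; rewrite star_adjC; have /forallP := px u.
Qed.

Lemma agree_off_recolor x v c : agree_off v x (recolor x v c).
Proof. by apply/agree_offP => u uv; rewrite ffunE (negbTE uv). Qed.

Lemma proper_recolor x v c : proper_col x -> allowed x v c -> proper_col (recolor x v c).
Proof.
move=> /proper_colP px; have [->|v0] := eqVneq v ord0.
  move=> /allowed_rootP xc; apply/proper_colP => u u0.
  by rewrite !ffunE eqxx (negbTE u0) xc.
rewrite allowed_leaf // => cx; apply/proper_colP => u u0; rewrite !ffunE.
by rewrite [ord0 == v]eq_sym (negbTE v0); case: ifP => // _; apply: px.
Qed.

Lemma nallowed_gt0 x v : proper_col x -> (0 < nallowed x v)%N.
Proof. by move=> px; apply/card_gt0P; exists (x v); rewrite inE proper_col_allowed. Qed.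

Lemma nallowed_leaf x v : v != ord0 -> nallowed x v = k.-1.
Proof.
move=> v0; rewrite /nallowed (eq_card (B := predC1 (x ord0))) ?cardC1 ?card_ord //.
by move=> c; rewrite !inE allowed_leaf.
Qed.

End StarColorings.

(** * Single-site updates as conditional expectations *)

Section HeatBath.
Context (R : realType) (b k : nat).
Implicit Types (x y : {ffun 'I_b.+1 -> 'I_k}) (v : 'I_b.+1) (c : 'I_k).

Definition state (i : 'I_#|{: coloring b k}|) : {ffun 'I_b.+1 -> 'I_k} :=
  val (enum_val i).

Lemma state_proper i : proper_col (state i).
Proof. exact: valP. Qed.

Lemma state_inj : injective state.
Proof. by move=> i j /val_inj/enum_val_inj. Qed.

Lemma sum_state (H : {ffun 'I_b.+1 -> 'I_k} -> R) :
  \sum_i H (state i) = \sum_(y | proper_col y) H y.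
Proof.
rewrite -(big_enum_val (A := {: coloring b k}) (fun s => H (val s))) /=.
rewrite (reindex_omap (op := +%R) (val : coloring b k -> _) insub) /=; last first.
  by move=> y py; rewrite insubT.
by apply: eq_bigl => s; rewrite valP valK eqxx.
Qed.

Definition heat_bath v : 'M[R]_(#|{: coloring b k}|) :=
  \matrix_(i, j)
    (if agree_off v (state i) (state j) && allowed (state i) v (state j v)
     then (nallowed (state i) v)%:R^-1 else 0).

Lemma glauberE : glauber R b k = (b.+1)%:R^-1 *: \sum_v heat_bath v.
Proof.
apply/matrixP => i j; rewrite !mxE summxE; congr (_ * _).
by apply: eq_bigr => v _; rewrite mxE.
Qed.

(** A proper target that agrees off [v] automatically carries a colour allowed at [v], so the
    support is the equivalence relation [agree_off v]. *)
Lemma heat_bathE v i j : heat_bath v i j =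
  if agree_off v (state i) (state j) then (nallowed (state i) v)%:R^-1 else 0.
Proof.
rewrite mxE; case: (boolP (agree_off _ _ _)) => //= ij.
by rewrite (allowed_agree_off _ ij) proper_col_allowed // state_proper.
Qed.

Lemma heat_bath_ge0 v i j : 0 <= heat_bath v i j.
Proof. by rewrite heat_bathE; case: ifP => // _; rewrite invr_ge0 ler0n. Qed.

(** [recolor] and evaluation at [v] are inverse bijections between allowed colours and reachable
    colourings. [H] is defined on all colourings, so that no properness proof enters the sum over
    [c]. *)
Lemma heat_bath_sum v i (H : {ffun 'I_b.+1 -> 'I_k} -> R) :
  \sum_j heat_bath v i j * H (state j) =
  (nallowed (state i) v)%:R^-1 * \sum_(c | allowed (state i) v c) H (recolor (state i) v c).
Proof.
under eq_bigr => j _ do rewrite mxE.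
rewrite (sum_state (fun y => (if agree_off v (state i) y && allowed (state i) v (y v)
     then (nallowed (state i) v)%:R^-1 else 0) * H y)).
rewrite (eq_bigr (fun y => if agree_off v (state i) y && allowed (state i) v (y v)
     then (nallowed (state i) v)%:R^-1 * H y else 0)); last first.
  by move=> y _; case: ifP => // _; rewrite mul0r.
rewrite -big_mkcondr /= mulr_sumr.
rewrite (reindex_onto (recolor (state i) v) (fun y => y v)) /=; last first.
  move=> y /and3P[_ /agree_offP iy _]; apply/ffunP => u; rewrite ffunE.
  by case: eqP => [->//|/eqP uv]; rewrite iy.
apply: eq_bigl => c; rewrite agree_off_recolor ffunE eqxx eqxx andbT /=.
by apply: andb_idl => ac; apply: proper_recolor => //; apply: state_proper.
Qed.

Lemma heat_bath_row v i : \sum_j heat_bath v i j = 1.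
Proof.
have := heat_bath_sum v i (fun=> 1); under eq_bigr do rewrite mulr1.
move=> ->; rewrite sumr_const -/(nallowed _ _) mulVf // pnatr_eq0 -lt0n.
by rewrite nallowed_gt0 // state_proper.
Qed.

Lemma heat_bath_const v : heat_bath v *m const_mx 1 = (const_mx 1 : 'cV_ _).
Proof.
apply/matrixP => i j; rewrite !mxE -[RHS](heat_bath_row v i).
by apply: eq_bigr => l _; rewrite [const_mx _ _ _]mxE mulr1.
Qed.

(** Row [i] is uniform on the class of [state i] under [agree_off v], and [nallowed] is constant on
    classes: the matrix is the conditional expectation given the colours off [v]. *)
Lemma heat_bath_proj v : orth_proj (heat_bath v).
Proof.
split; apply/matrixP => i j.
  rewrite mxE !heat_bathE agree_offC.
  by case: ifP => // ij; rewrite (nallowed_agree_off ij).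
rewrite mxE (eq_bigr (fun l => heat_bath v i l * heat_bath v i j)).
  by rewrite -mulr_suml heat_bath_row mul1r.
move=> l _; rewrite (heat_bathE v i l).
case: ifP => [il|_]; last by rewrite !mul0r.
rewrite !heat_bathE (nallowed_agree_off il).
suff -> : agree_off v (state l) (state j) = agree_off v (state i) (state j) by [].
move/agree_offP in il.
by apply/agree_offP/agree_offP => h u uv; [rewrite il | rewrite -il]; rewrite ?h.
Qed.

Lemma glauber_const : glauber R b k *m const_mx 1 = (const_mx 1 : 'cV_ _).
Proof.
rewrite glauberE -scalemxAl mulmx_suml; under eq_bigr do rewrite heat_bath_const.
by rewrite sumr_const card_ord -[const_mx 1 *+ _]scaler_nat scalerA mulVf ?scale1r // pnatr_eq0.
Qed.

(** A leaf update depends on the other colours only through the root colour, which [i] and [j]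
    share, so both can be given the same new colour [c]; the results then agree off the remaining
    list. With [s] all the leaves, only the root colour matters. *)
Lemma leaf_updates_root (s : seq 'I_b.+1) (h : 'cV[R]_(#|{: coloring b k}|)) i j :
  ord0 \notin s ->
  (forall l, l \notin s -> state i l = state j l) ->
  foldr (fun v w => heat_bath v *m w) h s i 0 =
  foldr (fun v w => heat_bath v *m w) h s j 0.
Proof.
elim: s i j => [|v s IH] i j /=.
  by move=> _ ij; congr (h _ _); apply: state_inj; apply/ffunP => l; apply: ij.
rewrite inE negb_or eq_sym => /andP[v0 s0] ij; set w := foldr _ _ _.
have r_ij : state i ord0 = state j ord0.
  by apply: ij; rewrite inE negb_or eq_sym v0.
(* [H] extends [w] by 0 beyond the proper colourings, the form that [heat_bath_sum] expects. *)
pose H y := if [pick l | state l == y] is Some l then w l 0 else 0.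
have HE l : H (state l) = w l 0.
  by rewrite /H; case: pickP => [l' /eqP/state_inj ->//|/(_ l)]; rewrite eqxx.
rewrite !mxE.
under eq_bigr => l _ do rewrite -HE.
under [RHS]eq_bigr => l _ do rewrite -HE.
rewrite !heat_bath_sum !nallowed_leaf //; congr (_ * _).
apply: eq_big => [c|c ac]; first by rewrite !allowed_leaf // r_ij.
have pick_state l : allowed (state l) v c ->
    exists l', state l' = recolor (state l) v c.
  move=> al; have pl := proper_recolor (state_proper l) al.
  by exists (enum_rank (Sub _ pl : coloring b k)); rewrite /state enum_rankK.
have [i' Ei] := pick_state i ac.
have aj : allowed (state j) v c.
  by move: ac; rewrite !allowed_leaf // r_ij.
have [j' Ej] := pick_state j aj.
rewrite -Ei -Ej !HE; apply: IH => // l ls; rewrite Ei Ej !ffunE.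
by case: eqP => // /eqP lv; apply: ij; rewrite inE negb_or lv.
Qed.

End HeatBath.

(** * Poincare inequality *)

(** Expanding the square yields [dot u u] twice, through the row sums and, by symmetry, the column
    sums, minus twice the cross term. *)
Lemma stochastic_dirichlet (R : realFieldType) (n : nat) (K : 'M[R]_n) (u : 'cV_n) :
  K^T = K -> (forall i, \sum_j K i j = 1) ->
  dot u u - dot u (K *m u) = 2^-1 * \sum_i \sum_j K i j * (u i 0 - u j 0) ^+ 2.
Proof.
move=> sK K1.
have uu : dot u u = \sum_i \sum_j K i j * u i 0 ^+ 2.
  by rewrite dotE; apply: eq_bigr => i _; rewrite -mulr_suml K1 mul1r expr2.
have uu' : dot u u = \sum_i \sum_j K i j * u j 0 ^+ 2.
  rewrite uu exchange_big /=; apply: eq_bigr => i _; apply: eq_bigr => j _.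
  by rewrite -{1}sK mxE.
have uKu : dot u (K *m u) = \sum_i \sum_j K i j * (u i 0 * u j 0).
  rewrite dotE; apply: eq_bigr => i _; rewrite mxE mulr_sumr.
  by apply: eq_bigr => j _; rewrite mulrCA.
have -> : \sum_i \sum_j K i j * (u i 0 - u j 0) ^+ 2 =
    dot u u + dot u u - 2 * dot u (K *m u).
  rewrite {1}uu uu' uKu mulr_sumr -!big_split -sumrB; apply: eq_bigr => i _ /=.
  rewrite mulr_sumr -!big_split -sumrB; apply: eq_bigr => j _ /=; ring.
lra.
Qed.

(** * Counting colourings whose leaves avoid given colours *)

Section Counting.
Context (b k : nat).
Implicit Types (x : {ffun 'I_b.+1 -> 'I_k}) (r s t : 'I_k) (B : {set 'I_k}).

(** With the root colour fixed the leaves are independent, each with [k - #|B|] choices. [B =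
    [set r]] expresses properness, [[set r; s]] that [s] is available to the root as well, and a
    third element [t] that [t] is too. *)
Definition leaves_avoid r B x :=
  (x ord0 == r) && [forall u : 'I_b.+1, (u != ord0) ==> (x u \notin B)].

Lemma card_leaves_avoid r B : #|[pred x | leaves_avoid r B x]| = ((k - #|B|) ^ b)%N.
Proof.
pose Q (u : 'I_b.+1) : pred 'I_k := if u == ord0 then pred1 r else [predC B].
transitivity #|family Q|.
  apply: eq_card => x; rewrite !inE /leaves_avoid; apply/andP/familyP => [[/eqP xr /forallP xB] u|xQ].
    rewrite /Q; case: eqP => [->|/eqP u0]; first by rewrite inE xr.
    by have := xB u; rewrite u0 inE.
  split; first by have := xQ ord0; rewrite /Q eqxx inE.
  by apply/forallP => u; apply/implyP => u0; have := xQ u; rewrite /Q (negbTE u0) inE.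
transitivity (\sum_(x in family Q) \prod_(u < b.+1) 1)%N.
  by rewrite -sum1_card; apply: eq_bigr => x _; rewrite big1.
rewrite -(bigA_distr_big_dep (fun u => Q u) (fun _ _ => 1%N)) big_ord_recl.
rewrite (eq_bigl (pred1 r)) ?big_pred1_eq; last by move=> j; rewrite /Q eqxx.
rewrite /= mul1n.
rewrite (eq_bigr (fun=> (k - #|B|)%N)) ?prod_nat_const ?card_ord // => u _.
rewrite /Q eq_sym (negbTE (neq_lift _ _)) sum1_card.
have kB : (#|B| + #|[predC B]| = k)%N by rewrite cardC card_ord.
by transitivity #|[predC B]|; [apply: eq_card | lia].
Qed.

Lemma proper_leaves_avoid r x :
  proper_col x && (x ord0 == r) = leaves_avoid r [set r] x.
Proof.
rewrite /leaves_avoid andbC; case: eqP => //= xr.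
apply/proper_colP/forallP => [h u|h u u0].
  by apply/implyP => /h; rewrite inE xr.
by have := h u; rewrite u0 inE xr.
Qed.

Lemma allowed_leaves_avoid r s x :
  [&& proper_col x, x ord0 == r & allowed x ord0 s] = leaves_avoid r [set r; s] x.
Proof.
rewrite andbA proper_leaves_avoid /leaves_avoid -andbA; congr (_ && _).
apply/andP/forallP => [[/forallP h1 /allowed_rootP h2] u|h].
  by have := h1 u; have := h2 u; rewrite !inE negb_or; case: eqP => //= _ /(_ isT) -> ->.
split; first by apply/forallP => u; have := h u; rewrite !inE negb_or; case: eqP => //= _ /andP[].
by apply/allowed_rootP => u u0; have := h u; rewrite u0 !inE negb_or => /andP[].
Qed.

(** Double counting of pairs [(x, t)] with [t] available at the root: [r] and [s] contribute
    [(k - 2)^b] each, any other [t] contributes [(k - 3)^b], and there are at most [k] of those. *)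
Lemma sum_nallowed_le r s : r != s ->
  (\sum_(x | leaves_avoid r [set r; s] x) nallowed x ord0 <=
   2 * (k - 2) ^ b + k * (k - 3) ^ b)%N.
Proof.
move=> rs.
rewrite (eq_bigr (fun x => \sum_(t | allowed x ord0 t) 1)%N); last by move=> x _; rewrite sum1_card.
rewrite (exchange_big_dep predT) //=.
have cnt t : (\sum_(x | leaves_avoid r [set r; s] x && allowed x ord0 t) 1 =
    (k - #|t |: [set r; s]|) ^ b)%N.
  rewrite -(card_leaves_avoid r) -sum1_card; apply: eq_bigl => x.
  rewrite !inE /leaves_avoid -andbA; congr (_ && _).
  apply/andP/forallP => [[/forallP h1 /allowed_rootP h2] u|h].
    by have := h1 u; have := h2 u; rewrite !inE; case: eqP => //= _ /(_ isT); rewrite !negb_or => -> .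
  split; first by apply/forallP => u; have := h u; rewrite !inE; case: eqP => //= _; rewrite !negb_or => /andP[].
  by apply/allowed_rootP => u u0; have := h u; rewrite u0 !inE !negb_or => /andP[].
under eq_bigr => t _ do rewrite cnt cardsU1 cards2 rs.
rewrite (bigID (fun t => t \in [set r; s])) /=; apply: leq_add.
  rewrite (eq_bigr (fun=> (k - 2) ^ b)%N); last by move=> t ->.
  by rewrite sum_nat_const cards2 rs.
rewrite (eq_bigr (fun=> (k - 3) ^ b)%N); last by move=> t ->.
by rewrite sum_nat_const leq_mul2r -[X in (_ <= X)%N](card_ord k) max_card orbT.
Qed.

End Counting.

(** Jensen's inequality for [1/m]: by [sum_nallowed_le] and the hypothesis, [nallowed] has mean at
    most 3 over these [(k - 2)^b] colourings, so its inverse has mean at least [1/3]. *)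
Lemma sum_inv_nallowed (R : realType) (b k : nat) (r s : 'I_k) : r != s ->
  (k * (k - 3) ^ b <= (k - 2) ^ b)%N ->
  ((k - 2) ^ b)%:R / 3 <=
  \sum_(x : {ffun 'I_b.+1 -> 'I_k} | leaves_avoid r [set r; s] x)
    (nallowed x ord0)%:R^-1 :> R.
Proof.
move=> rs hk; have := sum_nallowed_le b rs.
set M := (\sum_(x | _) _)%N => hM.
have {hM hk}hM : (M%:R : R) <= 3 * ((k - 2) ^ b)%:R by rewrite -natrM ler_nat; lia.
(* [1/m >= (6 - m)/9], the tangent line at [m = 3] *)
have tangent (m : nat) : (0 < m)%N -> (6 - m%:R) / 9 <= m%:R^-1 :> R.
  move=> m0; have m_gt0 : 0 < m%:R :> R by rewrite ltr0n.
  rewrite -(ler_pM2r m_gt0) mulVf ?gt_eqF //.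
  by have := sqr_ge0 (m%:R - 3 : R); rewrite expr2; lra.
apply: le_trans (_ : \sum_(x : {ffun 'I_b.+1 -> 'I_k} | leaves_avoid r [set r; s] x)
    (6 - (nallowed x ord0)%:R) / 9 <= _); last first.
  apply: ler_sum => x; rewrite -allowed_leaves_avoid => /and3P[px _ _].
  by apply/tangent/nallowed_gt0.
have cardS : #|leaves_avoid (b := b) r [set r; s]| = ((k - 2) ^ b)%N.
  by have := card_leaves_avoid b r [set r; s]; rewrite cards2 rs.
rewrite -mulr_suml sumrB sumr_const cardS -mulr_natr /M natr_sum in hM *.
set X := ((k - 2) ^ b)%:R in hM *; lra.
Qed.

Section Gap.
Context (R : realType) (b k : nat).
Let N := #|{: coloring b k}|.

(** This is [q k / 3], since [q = ((k - 2) / (k - 1))^b]. *)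
Definition root_rate : R := k%:R * ((k - 2) ^ b)%:R / (3 * ((k - 1) ^ b)%:R).

Lemma sum_by_root (G : 'I_k -> R) :
  \sum_(i < N) G (state i ord0) = ((k - 1) ^ b)%:R * \sum_r G r.
Proof.
rewrite (sum_state (fun x => G (x ord0))).
rewrite (partition_big (fun x : {ffun 'I_b.+1 -> 'I_k} => x ord0) predT) //= mulr_sumr.
apply: eq_bigr => r _; rewrite (eq_bigr (fun=> G r)) => [|x /andP[_ /eqP ->] //].
rewrite (eq_bigl _ _ (fun x => proper_leaves_avoid r x)) sumr_const.
by have := card_leaves_avoid b r [set r]; rewrite cards1 => -> ; rewrite mulr_natl.
Qed.

Lemma card_coloring : N = (k * (k - 1) ^ b)%N.
Proof.
have := sum_by_root (fun=> 1); rewrite !sumr_const !card_ord -natrM => /eqP.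
by rewrite eqr_nat mulnC => /eqP.
Qed.

Hypothesis k_gt2 : (2 < k)%N.
Hypothesis few_missing : (k * (k - 3) ^ b <= (k - 2) ^ b)%N.

(** On functions of the root colour, the root update is a weighted walk on the colours. Its weights
    dominate those of a complete graph with edge weight [(k - 2)^b / 3], whose Dirichlet form is
    explicit on zero-sum functions. *)
Lemma root_variance (g : 'cV[R]_N) (gam : 'I_k -> R) :
  (forall i, g i 0 = gam (state i ord0)) -> coord_sum g = 0 ->
  root_rate * dot g g <=
  dot (g - heat_bath R k ord0 *m g) (g - heat_bath R k ord0 *m g).
Proof.
move=> gE g0.
have pos : 0 < ((k - 1) ^ b)%:R :> R by rewrite ltr0n expn_gt0 subn_gt0 (ltnW k_gt2).
have gam0 : \sum_r gam r = 0.
  move: g0; rewrite /coord_sum; under eq_bigr do rewrite gE.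
  by rewrite sum_by_root => /eqP; rewrite mulf_eq0 gt_eqF //= => /eqP.
have ggE : dot g g = ((k - 1) ^ b)%:R * \sum_r gam r ^+ 2.
  rewrite dotE; under eq_bigr do rewrite gE -expr2.
  by rewrite (sum_by_root (fun r => gam r ^+ 2)).
have sqE : \sum_r \sum_s (gam r - gam s) ^+ 2 = 2 * k%:R * \sum_r gam r ^+ 2.
  transitivity (\sum_r (k%:R * gam r ^+ 2 + \sum_s gam s ^+ 2)).
    apply: eq_bigr => r _; transitivity
      (\sum_s (gam r ^+ 2 + gam s ^+ 2 - 2 * gam r * gam s)).
      by apply: eq_bigr => s _; ring.
    rewrite sumrB big_split /= -[X in _ - X]mulr_sumr gam0 mulr0 subr0 sumr_const card_ord.
    by rewrite mulr_natl.
  rewrite big_split /= -mulr_sumr sumr_const card_ord -mulr_natl; ring.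
have projK := heat_bath_proj R k (ord0 : 'I_b.+1).
rewrite orth_proj_compl // stochastic_dirichlet; [|by case: projK|exact: heat_bath_row].
(* [W r s] is the total weight with which the root update moves root colour [r] to [s], summed over
   the colourings of the leaves. *)
pose W r s : R := \sum_(x : {ffun 'I_b.+1 -> 'I_k} | leaves_avoid r [set r; s] x)
    (nallowed x ord0)%:R^-1.
have -> : \sum_i \sum_j heat_bath R k ord0 i j * (g i 0 - g j 0) ^+ 2 =
    \sum_r \sum_s (gam r - gam s) ^+ 2 * W r s.
  under eq_bigr => i _.
    under eq_bigr => j _ do rewrite !gE.
    rewrite (heat_bath_sum _ _ (fun y => (gam (state i ord0) - gam (y ord0)) ^+ 2)).
    under eq_bigr => c _ do rewrite ffunE eqxx.
    over.
  rewrite (sum_state (fun x => (nallowed x ord0)%:R^-1 *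
    \sum_(c | allowed x ord0 c) (gam (x ord0) - gam c) ^+ 2)).
  rewrite (partition_big (fun x : {ffun 'I_b.+1 -> 'I_k} => x ord0) predT) //=.
  apply: eq_bigr => r _; under eq_bigr => x _ do rewrite mulr_sumr.
  rewrite (exchange_big_dep predT) //=; apply: eq_bigr => s _.
  rewrite mulr_sumr; apply: eq_big => [x|x].
    by rewrite -andbA allowed_leaves_avoid.
  by case/andP => /andP[_ /eqP ->] _; rewrite mulrC.
(* On the diagonal the factor [gam r - gam s] vanishes; [sum_inv_nallowed] covers [r != s]. *)
have W_ge r s : (gam r - gam s) ^+ 2 * (((k - 2) ^ b)%:R / 3) <= (gam r - gam s) ^+ 2 * W r s.
  have [->|rs] := eqVneq r s; first by rewrite subrr expr0n !mul0r.
  by rewrite ler_wpM2l ?sqr_ge0 // sum_inv_nallowed.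
apply: le_trans (_ : 2^-1 * \sum_r \sum_s (gam r - gam s) ^+ 2 * (((k - 2) ^ b)%:R / 3) <= _).
  under eq_bigr do rewrite -mulr_suml.
  rewrite -mulr_suml sqE ggE /root_rate le_eqVlt; apply/orP; left; apply/eqP.
  by field; rewrite gt_eqF.
by rewrite ler_pM2l ?invr_gt0 // ler_sum // => r _; rewrite ler_sum.
Qed.

Lemma root_rate_gt0 : 0 < root_rate.
Proof.
rewrite /root_rate divr_gt0 ?mulr_gt0 ?ltr0n ?expn_gt0 ?subn_gt0 ?k_gt2 ?(ltnW k_gt2) //.
exact: ltn_trans k_gt2.
Qed.

(** With [S] the leaf energies and [E ord0] the root energy, [|u|^2 <= 2 |u - g|^2 + 2 |g|^2], where
    [|u - g|^2 <= S] and [root_rate |g|^2 <= 2 (E ord0 + S)]. This is the origin of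
    [2 + 4 / root_rate]. *)
Lemma star_poincare (u : 'cV[R]_N) : coord_sum u = 0 ->
  dot u u <= (2 + 4 / root_rate) *
    \sum_v dot (u - heat_bath R k v *m u) (u - heat_bath R k v *m u).
Proof.
move=> u0; have rate_gt0 := root_rate_gt0.
pose K (v : 'I_b.+1) := heat_bath R k v; pose E v := dot (u - K v *m u) (u - K v *m u).
pose s := [seq v <- enum 'I_b.+1 | v != ord0].
pose g := foldr (fun v w => K v *m w) u s.
have g0 : coord_sum g = 0.
  rewrite /g; elim: (s) => //= v s' IH; rewrite coord_sum_mulmx //.
    by case: (heat_bath_proj R k v).
  exact: heat_bath_const.
have leaves : dot (u - g) (u - g) <= \sum_(v | v != ord0) E v.
  have <- : \sum_(v <- s) E v = \sum_(v | v != ord0) E v.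
    by rewrite big_filter big_enum_cond.
  exact: orth_proj_foldr (heat_bath_proj R k).
(* Any state with root colour [r] serves as representative, since [g] depends on the root colour
   only; the default 0 is never read at a state. *)
pose gam r := if [pick i | state i ord0 == r] is Some i then g i 0 else 0.
have gE i : g i 0 = gam (state i ord0).
  rewrite /gam; case: pickP => [j /eqP ij|/(_ i)]; last by rewrite eqxx.
  apply: leaf_updates_root => [|l]; first by rewrite mem_filter eqxx.
  by rewrite mem_filter mem_enum andbT negbK => /eqP ->.
have rootE : root_rate * dot g g <= 2 * E ord0 + 2 * dot (u - g) (u - g).
  apply: le_trans (root_variance gE g0) _.
  have -> : g - K ord0 *m g = (u - K ord0 *m u) + - ((u - g) - K ord0 *m (u - g)).
    by rewrite mulmxBr; apply/matrixP => i j; rewrite !mxE; ring.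
  apply: le_trans (dot_add_sqr_le _ _) _; rewrite lerD2l ler_pM2l //.
  rewrite dotNr dotC dotNr opprK.
  exact: orth_proj_compl_contr (heat_bath_proj R k _).
have -> : \sum_v dot (u - heat_bath R k v *m u) (u - heat_bath R k v *m u) =
    E ord0 + \sum_(v | v != ord0) E v by rewrite (bigD1 ord0).
have := dot_add_sqr_le (u - g) g; rewrite subrK.
set S := \sum_(v | _) _ in leaves *; set d := dot (u - g) _ in leaves rootE *.
have d_ge0 : 0 <= d by apply: dotuu_ge0.
have E_ge0 : 0 <= E ord0 by apply: dotuu_ge0.
rewrite mulrC -ler_pdivlMr // in rootE => uu.
apply: le_trans uu _.
have : dot g g <= 2 * ((E ord0 + S) / root_rate).
  apply: le_trans rootE _; rewrite mulrA ler_pM2r ?invr_gt0 //; lra.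
have -> : (2 + 4 / root_rate) * (E ord0 + S) =
    2 * (E ord0 + S) + 2 * (2 * ((E ord0 + S) / root_rate)) by ring.
lra.
Qed.

End Gap.

(** * Density and mixing *)

Section Density.
Context (R : realType) (b k : nat).
Let N := #|{: coloring b k}|.
Let K (v : 'I_b.+1) : 'M[R]_N := heat_bath R k v.
Hypothesis k_gt1 : (1 < k)%N.

Definition agree_on (V : {set 'I_b.+1}) (z x : {ffun 'I_b.+1 -> 'I_k}) :=
  [forall v, (v \in V) ==> (x v == z v)].

(* Substochastic: the updates of [l] are dropped, not replaced. *)
Definition glauber_omit (l : 'I_b.+1) : 'M[R]_N :=
  (b.+1)%:R^-1 *: \sum_(v | v != l) K v.

(** [V] holds leaves only, so an update at [v] in [V] hits the colour [z v] with probability at most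
    [1 / (k - 1)], and the former colour of [v] ceases to matter: the constraint at [v] is traded
    for that factor. *)
Lemma heat_bath_agree (V : {set 'I_b.+1}) z v c (h : 'cV[R]_N) :
  ord0 \notin V -> 0 <= c ->
  (forall i, 0 <= h i 0 <= c * (agree_on V z (state i))%:R) ->
  forall i, 0 <= (K v *m h) i 0 <=
    (if v \in V then c / (k - 1)%:R else c) * (agree_on (V :\ v) z (state i))%:R.
Proof.
move=> V0 c_ge0 hh i; apply/andP; split.
  rewrite mxE sumr_ge0 // => j _; rewrite mulr_ge0 ?heat_bath_ge0 //.
  by case/andP: (hh j).
have Kh : (K v *m h) i 0 <= \sum_j K v i j * (c * (agree_on V z (state j))%:R).
  rewrite mxE ler_sum // => j _; rewrite ler_wpM2l ?heat_bath_ge0 //.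
  by case/andP: (hh j).
apply: le_trans Kh _; rewrite /K (heat_bath_sum v i (fun y => c * (agree_on V z y)%:R)) -mulr_sumr mulrCA.
have recolorV y : agree_on V z (recolor (state i) v y) ->
    agree_on (V :\ v) z (state i).
  move=> /forallP h1; apply/forallP => u; have := h1 u.
  by rewrite !inE ffunE; case: (u == v).
case: (boolP (agree_on (V :\ v) z (state i))) => [a1|a1]; last first.
  rewrite mulr0 big1 ?mulr0 // => y _.
  by case: (boolP (agree_on V z _)) => // /recolorV; rewrite (negbTE a1).
rewrite mulr1; case: ifP => vV.
  have v0 : v != ord0 by apply: contraNneq V0 => <-.
  rewrite nallowed_leaf // subn1 ler_wpM2l // -[leRHS]mulr1 ler_wpM2l ?invr_ge0 //.
  apply: le_trans (_ : \sum_(y | y == z v) 1 <= _); last by rewrite big_pred1_eq.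
  rewrite [leRHS]big_mkcond [leLHS]big_mkcond ler_sum //= => y _.
  case: ifP => _; last by case: ifP.
  case: (boolP (agree_on V z _)) => [/forallP/(_ v)|_]; last by case: ifP.
  by rewrite vV ffunE eqxx => /eqP ->; rewrite eqxx.
rewrite -[leRHS]mulr1 ler_wpM2l // ler_pdivrMl ?ltr0n ?nallowed_gt0 ?state_proper //.
rewrite mulr1 /nallowed -sum1_card natr_sum ler_sum // => y _.
by case: (agree_on _ _ _).
Qed.

(** Updates are peeled off from the last one backwards. Either every vertex of [V] is met, each
    contributing [1 / (k - 1)] at its last update, or some [l] in [V] is never selected; a union
    bound over [l] gives the sum. *)
Lemma glauber_pow_agree (L : nat) (V : {set 'I_b.+1}) z c (h : 'cV[R]_N) :
  ord0 \notin V -> 0 <= c ->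
  (forall i, 0 <= h i 0 <= c * (agree_on V z (state i))%:R) ->
  forall i, (glauber R b k ^+ L *m h) i 0 <=
    c / (k - 1)%:R ^+ #|V| + \sum_(l in V) (glauber_omit l ^+ L *m h) i 0.
Proof.
have k1_gt0 : 0 < (k - 1)%:R :> R by rewrite ltr0n subn_gt0.
elim: L V c h => [|L IH] V c h V0 c_ge0 hh i.
  have /andP[h_ge0 h_le] := hh i.
  rewrite expr0 mul1mx (eq_bigr (fun=> h i 0)) => [|l _]; last by rewrite ?expr0 ?mul1mx.
  (* With no update left, any [l] in [V] supplies the term [h i 0] itself; for empty [V] the bound
     [c] suffices. *)
  have [->|[l lV]] := set_0Vmem V.
    rewrite big_set0 addr0 cards0 divr1; apply: le_trans h_le _.
    by rewrite -[leRHS]mulr1 ler_wpM2l //; case: (agree_on _ _ _).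
  rewrite (bigD1 l) //= addrCA lerDl addr_ge0 ?divr_ge0 ?exprn_ge0 ?(ltW k1_gt0) //.
  by rewrite sumr_ge0.
(* With [v] as the last update, induction runs on [V :\ v]; for [v] in [V] the missing power of
   [k - 1] is the factor from [heat_bath_agree]. Only [l != v] remain, which matches the dropped
   term in [glauber_omit l]. *)
have step v : (glauber R b k ^+ L *m (K v *m h)) i 0 <=
    c / (k - 1)%:R ^+ #|V| +
    \sum_(l in V | v != l) (glauber_omit l ^+ L *m (K v *m h)) i 0.
  apply: le_trans (IH (V :\ v) (if v \in V then c / (k - 1)%:R else c) _ _ _ _ i) _.
  - by rewrite !inE negb_and V0 orbT.
  - by case: ifP => // _; rewrite divr_ge0 // ltW.
  - exact: heat_bath_agree.
  apply: lerD.
    case: ifP => vV; last first.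
      by rewrite (_ : V :\ v = V) //; apply/finset.setP => u; rewrite !inE; case: eqP => //= ->; rewrite vV.
    by rewrite (cardsD1 v V) vV add1n exprS invfM mulrA.
  rewrite le_eqVlt; apply/orP; left; apply/eqP; apply: eq_bigl => l.
  by rewrite !inE andbC eq_sym.
have -> : (glauber R b k ^+ L.+1 *m h) i 0 =
    (b.+1)%:R^-1 * \sum_v (glauber R b k ^+ L *m (K v *m h)) i 0.
  rewrite exprSr -mulmxE -mulmxA {2}glauberE -scalemxAl -scalemxAr mxE mulmx_suml.
  by rewrite mulmx_sumr summxE.
under [X in _ <= _ + X]eq_bigr => l _.
  rewrite exprSr -mulmxE -mulmxA {2}/glauber_omit -scalemxAl -scalemxAr mxE mulmx_suml.
  rewrite mulmx_sumr summxE.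
  over.
rewrite ler_pdivrMl ?ltr0n // mulrDr -mulr_sumr mulVKf ?pnatr_eq0 //.
rewrite (exchange_big_dep predT) //=.
rewrite mulr_natl -[X in _ *+ X]card_ord -sumr_const -big_split /= ler_sum // => v _.
Qed.

Lemma glauber_omit_ge0 l L i j : 0 <= (glauber_omit l ^+ L) i j.
Proof.
elim: L i j => [|L IH] i j; first by rewrite expr0 mxE ler0n.
rewrite exprS -mulmxE mxE sumr_ge0 // => m _; rewrite mulr_ge0 //.
rewrite /glauber_omit !mxE summxE mulr_ge0 ?invr_ge0 // sumr_ge0 // => v _.
exact: heat_bath_ge0.
Qed.

(** The surviving mass is the probability that [l] is not selected in [L] steps. *)
Lemma glauber_omit_row l L i :
  \sum_j (glauber_omit l ^+ L) i j = (b%:R / (b.+1)%:R) ^+ L.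
Proof.
have row1 m : \sum_j glauber_omit l m j = b%:R / (b.+1)%:R.
  under eq_bigr do rewrite /glauber_omit !mxE summxE.
  rewrite -mulr_sumr exchange_big /=.
  under eq_bigr do rewrite heat_bath_row.
  by rewrite sumr_const cardC1 card_ord mulrC.
elim: L i => [|L IH] i.
  rewrite !expr0 (bigD1 i) //= big1 ?mxE ?eqxx ?addr0 // => j ij.
  by rewrite mxE eq_sym (negbTE ij).
rewrite exprS -mulmxE; under eq_bigr do rewrite mxE.
rewrite exchange_big /=; under eq_bigr do rewrite -mulr_sumr IH.
by rewrite -mulr_suml row1 -exprS.
Qed.

(** [glauber_pow_agree] with [V] all the leaves, [c = 1], and [h] the indicator of [state j], which
    is dominated by agreement with [state j] on the leaves, the root being left free. *)
Lemma glauber_pow_le L i j :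
  (glauber R b k ^+ L) i j <=
  (k - 1)%:R ^- b + \sum_(l | l != ord0) (glauber_omit l ^+ L) i j.
Proof.
have colm (A : 'M[R]_N) : A i j = (A *m delta_mx j 0 : 'cV_N) i 0.
  by rewrite -colE mxE.
rewrite colm; apply: le_trans (glauber_pow_agree L (V := [set~ ord0]) (z := state j) (c := 1) _ _ _ i) _.
- by rewrite !inE eqxx.
- exact: ler01.
- move=> m; rewrite mxE eqxx andbT ler0n /= mul1r ler_nat.
  case: eqP => [->|//]; rewrite (_ : agree_on _ _ _) //.
  by apply/forallP => v; rewrite eqxx implybT.
rewrite cardsC1 card_ord mul1r lerD2l le_eqVlt; apply/orP; left; apply/eqP.
by apply: eq_big => [l|l _]; rewrite ?inE // -colm.
Qed.

End Density.

(** * From a density bound to total variation *)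

Section Mixing.
Context (R : realFieldType) (n : nat) (P : 'M[R]_n) (lam : R).
Hypothesis n_gt0 : (0 < n)%N.
Hypothesis symP : P^T = P.
Hypothesis P_ge0 : forall i j, 0 <= P i j.
Hypothesis P_const : P *m const_mx 1 = (const_mx 1 : 'cV_n).
Hypothesis P_contr : forall w : 'cV_n, coord_sum w = 0 ->
  dot (P *m w) (P *m w) <= lam ^+ 2 * dot w w.

Lemma pow_const t (a : R) : P ^+ t *m const_mx a = (const_mx a : 'cV_n).
Proof.
have -> : const_mx a = a *: const_mx 1 :> 'cV_n.
  by apply/matrixP => i j; rewrite !mxE mulr1.
rewrite -scalemxAr; congr (_ *: _); elim: t => [|t IH]; first by rewrite expr0 mul1mx.
by rewrite exprSr -mulmxE -mulmxA P_const.
Qed.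

(** By symmetry the columns of [P] also sum to 1. This controls the part of a distribution that has
    no density bound. *)
Lemma l1_contraction t (w : 'cV[R]_n) :
  \sum_i `|(P ^+ t *m w) i 0| <= \sum_i `|w i 0|.
Proof.
elim: t => [|t IH]; first by rewrite expr0 mul1mx.
apply: le_trans IH; rewrite exprS -mulmxE -mulmxA; set v := P ^+ t *m w.
apply: le_trans (_ : \sum_i \sum_j P i j * `|v j 0| <= _).
  apply: ler_sum => i _; rewrite mxE; apply: le_trans (ler_norm_sum _ _ _) _.
  by apply: ler_sum => j _; rewrite normrM ger0_norm.
rewrite exchange_big /= le_eqVlt; apply/orP; left; apply/eqP.
apply: eq_bigr => j _; rewrite -mulr_suml.
have /matrixP/(_ j 0) := P_const; rewrite !mxE => Pj.
rewrite (_ : \sum_i P i j = 1) ?mul1r // -Pj; apply: eq_bigr => i _.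
by rewrite -{1}symP !mxE mulr1.
Qed.

(** Truncate [p] at [D / n] and centre both pieces. The truncated piece has squared norm at most
    [D / n], so the [l^2] contraction and Cauchy-Schwarz bound it by [s]. The excess has mass at
    most [eps], and centring at most doubles its [l^1] norm. *)
Lemma l1_mixing (p : 'cV[R]_n) (e : 'I_n -> R) (D eps s : R) (t : nat) :
  (forall i, 0 <= p i 0) -> coord_sum p = 1 -> 0 <= D ->
  (forall i, 0 <= e i) -> (forall i, p i 0 <= D / n%:R + e i) ->
  \sum_i e i <= eps -> 0 <= s -> (lam ^+ t) ^+ 2 * D <= s ^+ 2 ->
  \sum_i `|(P ^+ t *m p) i 0 - n%:R^-1| <= s + 2 * eps.
Proof.
move=> p_ge0 p1 D_ge0 e_ge0 p_le e_le s_ge0 lamD.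
have nR_gt0 : 0 < n%:R :> R by rewrite ltr0n.
have Dn_ge0 : 0 <= D / n%:R by rewrite divr_ge0 // ltW.
pose a : 'cV[R]_n := \col_i Num.min (p i 0) (D / n%:R).
pose r : 'cV[R]_n := p - a.
have aE i : a i 0 = Num.min (p i 0) (D / n%:R) by rewrite mxE.
have a_ge0 i : 0 <= a i 0 by rewrite aE le_min p_ge0.
have a_leD i : a i 0 <= D / n%:R by rewrite aE ge_min lexx orbT.
have a_lep i : a i 0 <= p i 0 by rewrite aE ge_min lexx.
have rE i : r i 0 = p i 0 - a i 0 by rewrite !mxE.
have r_ge0 i : 0 <= r i 0 by rewrite rE subr_ge0.
have r_le i : r i 0 <= e i.
  by rewrite rE aE lerBlDr addrC; case: (leP (p i 0) (D / n%:R)) => _; [rewrite lerDl | apply: p_le].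
have sum_avg (c : R) : \sum_(i < n) c / n%:R = c.
  by rewrite -mulr_suml sumr_const card_ord -[c *+ n]mulr_natr mulfK // gt_eqF.
pose center (w : 'cV[R]_n) : 'cV_n := w - const_mx (coord_sum w / n%:R).
have centerE w i : center w i 0 = w i 0 - coord_sum w / n%:R by rewrite !mxE.
have center0 w : coord_sum (center w) = 0.
  rewrite /coord_sum; under eq_bigr do rewrite centerE.
  by rewrite sumrB sum_avg subrr.
have ar1 : coord_sum a + coord_sum r = 1.
  by rewrite -big_split /= -p1; apply: eq_bigr => i _; rewrite rE addrC subrK.
(* The two subtracted means add up to [1 / n] because the masses of [a] and [r] add up to 1. *)
have split_p i : (P ^+ t *m p) i 0 - n%:R^-1 =
    (P ^+ t *m center a) i 0 + (P ^+ t *m center r) i 0.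
  have -> : P ^+ t *m p = P ^+ t *m a + P ^+ t *m r by rewrite -mulmxDr addrC subrK.
  rewrite /center [P ^+ t *m (a - _)]mulmxBr [P ^+ t *m (r - _)]mulmxBr !pow_const.
  move: (P ^+ t *m a) (P ^+ t *m r) => u v; rewrite !mxE.
  rewrite -[X in _ - X = _]mul1r -ar1; ring.
have a_part : \sum_i `|(P ^+ t *m center a) i 0| <= s.
  rewrite -(ler_pXn2r (n := 2)) ?nnegrE ?sumr_ge0 //.
  apply: le_trans (cauchy_schwarz_l1 _) _; apply: le_trans lamD.
  have [h _] := contraction_iter t symP P_const P_contr (center0 a).
  apply: le_trans (_ : n%:R * ((lam ^+ t) ^+ 2 * (D / n%:R)) <= _); last first.
    by rewrite le_eqVlt; apply/orP; left; apply/eqP; field; rewrite gt_eqF.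
  rewrite ler_pM2l //; apply: le_trans h _; rewrite ler_wpM2l ?sqr_ge0 //.
  apply: le_trans (_ : dot a a <= _).
    rewrite /center dotBl !dotBr !dot_const (dotC a) dot_const.
    have -> : coord_sum (const_mx (coord_sum a / n%:R) : 'cV[R]_n) = coord_sum a.
      rewrite /coord_sum; under eq_bigr do rewrite mxE.
      exact: sum_avg.
    have : 0 <= coord_sum a / n%:R * coord_sum a.
      by rewrite mulrAC -expr2 divr_ge0 ?sqr_ge0 ?ltW.
    lra.
  rewrite dotE; apply: le_trans (_ : \sum_i (D / n%:R) * a i 0 <= _).
    by apply: ler_sum => i _; rewrite ler_wpM2r.
  rewrite -mulr_sumr -[leRHS]mulr1 ler_wpM2l // -ar1 lerDl.
  by apply: sumr_ge0.
have r_part : \sum_i `|(P ^+ t *m center r) i 0| <= 2 * eps.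
  apply: le_trans (l1_contraction _ _) _.
  have r_eps : coord_sum r <= eps by apply: le_trans e_le; apply: ler_sum.
  have rs_ge0 : 0 <= coord_sum r by apply: sumr_ge0.
  apply: le_trans (_ : \sum_i (r i 0 + coord_sum r / n%:R) <= _).
    apply: ler_sum => i _; rewrite centerE.
    apply: le_trans (ler_normB _ _) _; rewrite !ger0_norm //.
    by rewrite divr_ge0 // ltW.
  rewrite big_split /= sum_avg.
  rewrite -/(coord_sum r); lra.
under eq_bigr do rewrite split_p.
apply: le_trans (_ : \sum_i (`|(P ^+ t *m center a) i 0| + `|(P ^+ t *m center r) i 0|) <= _).
  by apply: ler_sum => i _; apply: ler_normD.
by rewrite big_split lerD.
Qed.

End Mixing.

(** * Second eigenvalue *)

(* Both sides are [x * \det (block_mx x%:M u v 1%:M)]. *)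
Lemma det_scalar_sub_rank1 (R : comNzRingType) (n : nat) (x : R) (u : 'cV[R]_n) (v : 'rV[R]_n) :
  x * \det (x%:M - u *m v) = x ^+ n * (x - (v *m u) 0 0).
Proof.
pose M := block_mx x%:M u v (1%:M : 'M[R]_1).
have detl : \det M = \det (x%:M - u *m v).
  have ME : M *m block_mx 1%:M 0 (- v) 1%:M = block_mx (x%:M - u *m v) u 0 1%:M.
    rewrite mulmx_block !mulmx1 !mulmx0 mul1mx !mulmxN !add0r.
    by rewrite subrr.
  by have := congr1 determinant ME; rewrite det_mulmx det_lblock det_ublock !det1 !mulr1.
have : \det M * x = x ^+ n * (x - (v *m u) 0 0).
  have ME : M *m block_mx 1%:M (- u) 0 x%:M = block_mx x%:M 0 v (x%:M - v *m u).
    rewrite mulmx_block !mulmx1 !mulmx0 mul1mx !mulmxN !addr0.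
    by rewrite mul_scalar_mx mul_mx_scalar addNr addrC.
  have := congr1 determinant ME; rewrite det_mulmx !det_ublock det_lblock !det_scalar !expr1n mul1r expr1 => ->.
  by rewrite det_mx11 !mxE mulr1n.
by rewrite detl mulrC.
Qed.

(** Deflation replaces the eigenvalue 1 of [u] by 0. For [Q = A - u v] one has [Q u v = 0], hence
    [(X - Q) (X - u v) = X (X - A)]; take determinants, use the rank-one formula for [u v], and
    cancel [X^n]. *)
Lemma char_poly_deflate (F : fieldType) (n : nat) (A : 'M[F]_n) (u : 'cV_n) (v : 'rV_n) :
  A *m u = u -> (v *m u) 0 0 = 1 ->
  'X * char_poly A = char_poly (A - u *m v) * ('X - 1%:P).
Proof.
move=> Au vu; pose Q := A - u *m v.
have vu1 : v *m u = 1%:M by rewrite [LHS]mx11_scalar vu.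
have QE : Q *m (u *m v) = 0.
  by rewrite mulmxBl mulmxA Au mulmxA -[u *m v *m u]mulmxA vu1 mulmx1 subrr.
have prodE : char_poly_mx Q *m char_poly_mx (u *m v) = 'X *: char_poly_mx A.
  rewrite /char_poly_mx mulmxBl !mulmxBr -map_mxM QE map_mx0 subr0.
  rewrite mul_scalar_mx mul_scalar_mx mul_mx_scalar -scalerBr -scalerBr.
  by rewrite -addrA -opprD -map_mxD subrKC.
have charE : 'X * char_poly (u *m v) = 'X^n * ('X - 1%:P).
  rewrite /char_poly /char_poly_mx map_mxM det_scalar_sub_rank1; congr (_ * (_ - _)).
  by rewrite -map_mxM mxE vu.
have := congr1 determinant prodE; rewrite det_mulmx detZ.
rewrite -/(char_poly Q) -/(char_poly A) -/(char_poly (u *m v)) => detE.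
apply: (mulfI (x := 'X^n)); first by rewrite expf_neq0 ?polyX_eq0.
by rewrite mulrCA -detE mulrCA charE mulrCA.
Qed.

Section SecondEigenvalue.
Context (R : realType) (n : nat) (P : 'M[R]_n) (lam : R).
Hypothesis n_gt0 : (0 < n)%N.
Hypothesis symP : P^T = P.
Hypothesis P_const : P *m const_mx 1 = (const_mx 1 : 'cV_n).
Hypothesis P_contr : forall w : 'cV_n, coord_sum w = 0 ->
  dot (P *m w) (P *m w) <= lam ^+ 2 * dot w w.
Hypothesis lam_ge0 : 0 <= lam.

Let A : 'M[R[i]]_n := map_mx (fun x : R => (x%:C)%C) P.
Let one : 'cV[R[i]]_n := const_mx 1.

Lemma complexification_const : A *m one = one.
Proof.
have := congr1 (map_mx (fun x : R => (x%:C)%C)) P_const.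
by rewrite map_mxM map_const_mx.
Qed.

Lemma Re_sum (I : finType) (F : I -> R[i]) :
  complex.Re (\sum_i F i) = \sum_i complex.Re (F i).
Proof. by apply: (big_morph (@complex.Re R)) => // -[? ?] [? ?]. Qed.

Lemma Im_sum (I : finType) (F : I -> R[i]) :
  complex.Im (\sum_i F i) = \sum_i complex.Im (F i).
Proof. by apply: (big_morph (@complex.Im R)) => // -[? ?] [? ?]. Qed.

(** [P] acts on the real and imaginary parts [u], [w] of [v] as multiplication by [mu], so [|P u|^2
    + |P w|^2 = |mu|^2 (|u|^2 + |w|^2)]. Both parts have zero sum, and the real contraction applies
    to each. *)
Lemma cmod_eigenvalue_le (v : 'rV[R[i]]_n) (mu : R[i]) :
  v != 0 -> v *m one = 0 -> v *m A = mu *: v -> cmod mu <= lam.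
Proof.
move=> v_neq0 v1 vA.
pose u : 'cV[R]_n := \col_j complex.Re (v 0 j).
pose w : 'cV[R]_n := \col_j complex.Im (v 0 j).
have vsum : \sum_j v 0 j = 0.
  have /matrixP/(_ 0 0) := v1; rewrite !mxE => {2}<-.
  by apply: eq_bigr => j _; rewrite mxE mulr1.
have u0 : coord_sum u = 0.
  rewrite /coord_sum; under eq_bigr do rewrite mxE.
  by rewrite -Re_sum vsum.
have w0 : coord_sum w = 0.
  rewrite /coord_sum; under eq_bigr do rewrite mxE.
  by rewrite -Im_sum vsum.
have vAj j : \sum_i v 0 i * (P i j)%:C%C = mu * v 0 j.
  have /matrixP/(_ 0 j) := vA; rewrite !mxE => <-.
  by apply: eq_bigr => i _; rewrite mxE.
have PuE : P *m u = complex.Re mu *: u - complex.Im mu *: w.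
  apply/matrixP => j l; rewrite ord1 !mxE.
  transitivity (complex.Re (mu * v 0 j)); last by case: (mu) (v 0 j) => [a b] [c d].
  rewrite -vAj Re_sum; apply: eq_bigr => i _.
  rewrite -{1}symP !mxE; case: (v 0 i) => [a b] /=; ring.
have PwE : P *m w = complex.Im mu *: u + complex.Re mu *: w.
  apply/matrixP => j l; rewrite ord1 !mxE.
  transitivity (complex.Im (mu * v 0 j)); last first.
    by case: (mu) (v 0 j) => [a b] [c d] /=; rewrite addrC.
  rewrite -vAj Im_sum; apply: eq_bigr => i _.
  rewrite -{1}symP !mxE; case: (v 0 i) => [a b] /=; ring.
have dsq : dot (P *m u) (P *m u) + dot (P *m w) (P *m w) =
    (complex.Re mu ^+ 2 + complex.Im mu ^+ 2) * (dot u u + dot w w).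
  rewrite PuE PwE !(dotBl, dotBr, dotDl, dotDr, dotZl, dotZr) (dotC w u); ring.
have d_gt0 : 0 < dot u u + dot w w.
  rewrite lt_neqAle addr_ge0 ?dotuu_ge0 // andbT eq_sym; apply: contra v_neq0.
  rewrite paddr_eq0 ?dotuu_ge0 // => /andP[/eqP/dotuu_eq0 ue /eqP/dotuu_eq0 we].
  apply/eqP/matrixP => i j; rewrite ord1 mxE.
  have /matrixP/(_ j 0) := ue; have /matrixP/(_ j 0) := we; rewrite !mxE.
  by case: (v 0 j) => [a b] /= -> ->.
rewrite /cmod -(ger0_norm lam_ge0) -sqrtr_sqr ler_wsqrtr //.
rewrite -(ler_pM2r d_gt0) -dsq mulrDr; apply: lerD; exact: P_contr.
Qed.

(** Two facts are needed: 1 is a simple root, which selects the second branch of [slem], and every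
    eigenvalue other than 1 has a left eigenvector orthogonal to the constants. *)
Lemma slem_le : lam < 1 -> slem P <= lam.
Proof.
move=> lam_lt1; pose v : 'rV[R[i]]_n := const_mx n%:R^-1.
have no_fixed (x : 'rV[R[i]]_n) : x != 0 -> x *m one = 0 -> x *m A = x -> False.
  move=> x0 x1 xA; have := @cmod_eigenvalue_le x 1 x0 x1.
  rewrite scale1r xA => /(_ erefl); rewrite /cmod /= expr1n expr0n addr0 sqrtr1.
  by rewrite leNgt lam_lt1.
have v1 : (v *m one) 0 0 = 1.
  rewrite mxE; under eq_bigr do rewrite !mxE mulr1.
  by rewrite sumr_const card_ord -[_ *+ n]mulr_natr mulVf // pnatr_eq0 -lt0n.
have simple : (mup 1 (cchar P) <= 1)%N.
  have nz : cchar P != 0 := monic_neq0 (char_poly_monic _).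
  rewrite leqNgt mup_geq //; apply/negP => dv.
  (* If [(X - 1)^2] divided the characteristic polynomial, deflation would leave 1 as an eigenvalue
     of [A - one *m v], with a left eigenvector [y] that is orthogonal to [one] and fixed by [A]. *)
  have /dvdp_trans/(_ (dvdp_mull 'X (dvdpp (cchar P)))) := dv.
  rewrite (char_poly_deflate complexification_const v1) expr2 dvdp_mul2r ?polyXsubC_eq0 //.
  rewrite dvdp_XsubCl -eigenvalue_root_char => /eigenvalueP[y yE y0].
  have yA : y *m A = y + y *m one *m v.
    by apply/eqP; rewrite -subr_eq -mulmxA -mulmxBr yE scale1r.
  have y1 : y *m one = 0.
    have yA1 : y *m A *m one = y *m one by rewrite -mulmxA complexification_const.
    have yv1 : y *m one *m v *m one = y *m one.
      by rewrite -[LHS]mulmxA [v *m one]mx11_scalar v1 mulmx1.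
    have := congr1 (mulmx^~ one) yA; rewrite /= yA1 mulmxDl yv1.
    by move=> /eqP; rewrite -subr_eq0 opprD addrA subrr add0r oppr_eq0 => /eqP.
  by apply: (no_fixed y) => //; rewrite yA y1 mul0mx addr0.
rewrite /slem ltnNge simple /=; set S := (X in sup X).
(* Without eigenvalues other than 1 the supremum is that of the empty set, which is 0 by
   convention. *)
have [[x Sx]|S0] := pselect (S !=set0)%classic; last first.
  rewrite (_ : S = set0); first by rewrite sup0.
  by rewrite -subset0 => x Sx; apply: S0; exists x.
apply: ge_sup; first by exists x.
move=> _ [mu [mu_root mu1] <-].
move: mu_root; rewrite /cchar -eigenvalue_root_char => /eigenvalueP[y yE y0].
apply: (@cmod_eigenvalue_le y) => //.
have := congr1 (mulmx^~ one) yE.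
rewrite /= -[_ *m one in LHS]mulmxA complexification_const -scalemxAl.
move=> /eqP; rewrite -subr_eq0 -[X in X - _]scale1r -scalerBl scaler_eq0 subr_eq0.
by rewrite eq_sym (negbTE mu1) /= => /eqP.
Qed.

Lemma trel_le : lam < 1 -> (trel P <= ((1 - lam)^-1)%:E)%E.
Proof.
move=> lam_lt1; have sl := slem_le lam_lt1.
rewrite /trel (le_lt_trans sl lam_lt1) lee_fin lef_pV2 ?posrE ?subr_gt0 //.
  by rewrite lerB.
exact: le_lt_trans sl lam_lt1.
Qed.

End SecondEigenvalue.

(** * Bounds for the star *)

Lemma tr_pow (R : realFieldType) (n : nat) (P : 'M[R]_n) m : P^T = P -> (P ^+ m)^T = P ^+ m.
Proof.
move=> sP; elim: m => [|m IH]; first by rewrite expr0 trmx1.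
by rewrite [in LHS]exprS -mulmxE trmx_mul IH sP mulmxE -exprSr.
Qed.

Section StarGlauber.
Context (R : realType) (b k : nat).
Let n := #|{: coloring b k}|.
Let P : 'M[R]_n := glauber R b k.
Hypothesis k_gt2 : (2 < k)%N.
Hypothesis few_missing : (k * (k - 3) ^ b <= (k - 2) ^ b)%N.

(** The Poincare constant of [star_poincare] times the number of vertices: the inverse of the gap
    that [avg_proj_gap] provides. *)
Definition relax_bound : R := (2 + 4 / root_rate R b k) * (b.+1)%:R.
Let lam : R := 1 - relax_bound^-1.

Lemma relax_bound_gt1 : 1 < relax_bound.
Proof.
have h := root_rate_gt0 R b k_gt2.
have h1 : 2 < 2 + 4 / root_rate R b k by rewrite ltrDl divr_gt0.
have h2 : 1 <= (b.+1)%:R :> R by rewrite ler1n.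
rewrite /relax_bound; nra.
Qed.

Lemma lam_gt0 : 0 < lam.
Proof. by rewrite /lam subr_gt0 invf_lt1 ?relax_bound_gt1 // (lt_trans _ relax_bound_gt1). Qed.

Lemma card_coloring_gt0 : (0 < n)%N.
Proof. by rewrite /n (card_coloring R b k) muln_gt0 expn_gt0 subn_gt0; apply/andP; split; lia. Qed.

Lemma glauber_sym : P^T = P.
Proof.
rewrite /P glauberE -[in (b.+1)%:R](card_ord b.+1).
exact: avg_proj_sym (heat_bath_proj R k).
Qed.

Lemma glauber_ge0 i j : 0 <= P i j.
Proof.
rewrite /P glauberE mxE summxE mulr_ge0 ?invr_ge0 // sumr_ge0 // => v _.
exact: heat_bath_ge0.
Qed.

Lemma glauber_contraction (w : 'cV[R]_n) : coord_sum w = 0 ->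
  dot (P *m w) (P *m w) <= lam ^+ 2 * dot w w.
Proof.
move=> w0; have PE : P = (#|'I_b.+1|%:R)^-1 *: \sum_v heat_bath R k v.
  by rewrite /P glauberE card_ord.
have projK := heat_bath_proj R k : forall v : 'I_b.+1, orth_proj (heat_bath R k v).
apply: psd_contraction => //.
- exact: glauber_sym.
- by move=> u; rewrite PE; apply: avg_proj_psd.
- exact: lam_gt0.
- move=> u u0; rewrite PE /lam /relax_bound -[in (b.+1)%:R](card_ord b.+1).
  apply: avg_proj_gap => //; first by rewrite card_ord.
    by rewrite addr_gt0 // divr_gt0 // root_rate_gt0.
  exact: star_poincare.
- by rewrite coord_sum_mulmx //; [exact: glauber_sym | exact: glauber_const].
Qed.

Lemma star_trel : (trel P <= relax_bound%:E)%E.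
Proof.
have -> : relax_bound = (1 - lam)^-1 by rewrite /lam opprB addrC subrK invrK.
apply: trel_le.
- exact: card_coloring_gt0.
- exact: glauber_sym.
- exact: glauber_const.
- exact: glauber_contraction.
- exact: ltW lam_gt0.
- by rewrite /lam ltrBlDr ltrDl invr_gt0 (lt_trans _ relax_bound_gt1).
Qed.

(** The first [L] steps bring the density to at most [k], up to a mass [eps] for leaves never
    selected; the next [t] steps contract. The factor [1/2] of total variation turns the target
    [1 / (2 e)] into [1 / e]. *)
Lemma star_mixed (L t : nat) (eps s : R) :
  b%:R * (b%:R / (b.+1)%:R) ^+ L <= eps -> 0 <= s ->
  (lam ^+ t) ^+ 2 * k%:R <= s ^+ 2 -> s + 2 * eps <= (expR 1)^-1 ->
  mixed_at P (t + L).
Proof.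
move=> Leps s0 ts total_le i; rewrite /tv_from invfM ler_pM2l ?invr_gt0 //.
apply: le_trans total_le.
pose p : 'cV[R]_n := P ^+ L *m delta_mx i 0.
have powE m j : (P ^+ m) i j = (P ^+ m *m delta_mx i 0 : 'cV_n) j 0.
  by rewrite -colE mxE -[in LHS](tr_pow m glauber_sym) mxE.
under eq_bigr do rewrite powE exprD -mulmxE -mulmxA -/p.
apply: (@l1_mixing _ _ P lam _ _ _ _ _ p
  (fun j => \sum_(l | l != ord0) (glauber_omit R k l ^+ L) i j) k%:R) => //.
- exact: card_coloring_gt0.
- exact: glauber_sym.
- exact: glauber_ge0.
- exact: glauber_const.
- exact: glauber_contraction.
- move=> j; rewrite /p -powE; elim: L i j {Leps p powE} => [|m IH] i j.
    by rewrite expr0 mxE ler0n.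
  rewrite exprS -mulmxE mxE sumr_ge0 // => l _.
  by rewrite mulr_ge0 // glauber_ge0.
- rewrite /p; have -> : coord_sum (P ^+ L *m delta_mx i 0) = coord_sum (delta_mx i 0 : 'cV[R]_n).
    rewrite coord_sum_mulmx ?(tr_pow _ glauber_sym) //.
    by apply: pow_const; apply: glauber_const.
  rewrite /coord_sum (bigD1 i) //= mxE !eqxx big1 ?addr0 // => j ji.
  by rewrite mxE (negbTE ji).
- by move=> j; apply: sumr_ge0 => l _; apply: glauber_omit_ge0.
- move=> j; rewrite /p -powE; apply: le_trans (glauber_pow_le R (ltnW k_gt2) L i j) _.
  (* As [n = k (k - 1)^b], the bound [(k - 1)^-b] equals [k / n], so [D = k]. *)
  rewrite lerD2r /n (card_coloring R b k) natrM natrX invfM mulrA mulfV ?mul1r //.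
  by rewrite pnatr_eq0; lia.
- apply: le_trans Leps; rewrite exchange_big /=.
  rewrite (eq_bigr (fun=> (b%:R / b.+1%:R) ^+ L)) => [|l _]; last exact: glauber_omit_row.
  by rewrite sumr_const cardC1 card_ord [leRHS]mulr_natl.
Qed.

End StarGlauber.

(** * Asymptotics for [k] the integer part of [C b / ln b] *)

Section Estimates.
Context (R : realType).

Lemma pow1B_le_expR (x : R) (m : nat) : x <= 1 -> (1 - x) ^+ m <= expR (- (m%:R * x)).
Proof.
move=> x1; rewrite -mulrN expRM_natl lerXn2r ?nnegrE ?subr_ge0 ?expR_ge0 //.
exact: expR_ge1Dx.
Qed.

(** Square the bound [e^(1/2) <= 2], which follows from [1 - 1/2 <= e^(-1/2)]. *)
Lemma expR1_le4 : expR 1 <= 4 :> R.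
Proof.
have e2 : expR 1 = expR (2^-1) ^+ 2 :> R by rewrite -expRM_natl mulfV.
have := expR_ge1Dx (- 2^-1 : R); rewrite expRN.
have e0 := expR_gt0 (2^-1 : R); set x := expR 2^-1 in e2 e0 *.
rewrite -(ler_pM2r e0) mulVf ?gt_eqF // => h.
by rewrite e2 expr2; nra.
Qed.

Lemma ln_cube_le (b : nat) : (0 < b)%N -> 0 <= ln (b%:R : R) -> ln (b%:R : R) ^+ 3 <= 6 * b%:R.
Proof.
move=> b0 l0; have := expR_ge1Dxn 2 l0; rewrite lnK ?posrE ?ltr0n // => h.
have -> : (6 : R) = 3`!%:R by [].
rewrite mulrC -ler_pdivrMr ?ltr0n ?fact_gt0 //; lra.
Qed.

Lemma star_regime (C : R) (b k : nat) : 0 < C -> C <= 1 ->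
  60 / C <= ln (b%:R : R) -> 36 / C ^+ 2 <= ln (b%:R : R) ->
  k%:R <= C * b%:R / ln (b%:R : R) < k%:R + 1 ->
  [/\ (2 < k)%N, (k <= b)%N, (k * (k - 3) ^ b <= (k - 2) ^ b)%N &
   relax_bound R b k <= (4 + 192 / C) * (b%:R `^ C^-1) * ln (b%:R : R)].
Proof.
move=> C0 C1; set l := ln _ => hl1 hl2 /andP[ky yk].
have C_neq0 : C != 0 by rewrite gt_eqF.
have Cl : 60 <= C * l by rewrite mulrC -ler_pdivrMr.
have l60 : 60 <= l by nra.
have l0 : 0 < l by lra.
have C2l : 36 <= C ^+ 2 * l by rewrite mulrC -ler_pdivrMr ?exprn_gt0.
have b0 : (0 < b)%N.
  by case: b @l {hl1 hl2 ky yk Cl l60 C2l} l0 => // l; rewrite /l ln0 // ltxx.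
have bR : 0 < b%:R :> R by rewrite ltr0n.
have eb : expR l = b%:R by rewrite lnK.
have cube := ln_cube_le b0 (ltW l0); rewrite -/l in cube.
set y := C * b%:R / l in ky yk.
have yl : y * l = C * b%:R by rewrite divfK // gt_eqF.
have yC : C * l ^+ 2 <= 6 * y.
  rewrite -(ler_pM2r l0) -[leRHS]mulrA yl.
  have -> : C * l ^+ 2 * l = C * l ^+ 3 by ring.
  by rewrite [leRHS]mulrCA ler_pM2l.
have y_ge10 : 10 <= y by rewrite expr2 in yC; nra.
(* This is what makes the rounding of [y] to [k] harmless in the exponents below; it combines
   [l^3 <= 6 b] with the threshold [36 / C^2]. *)
have y_ge : 6 * (l / C) <= y.
  have : 36 * l <= C ^+ 2 * l * l by rewrite ler_pM2r.
  rewrite mulrA ler_pdivrMr // expr2 in yC *.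
  move=> h; have : C * (C * (l * l)) <= C * (6 * y) by rewrite ler_pM2l.
  lra.
have lC : l <= l / C by rewrite ler_pdivlMr // ler_piMr // ltW.
have kR : 9 < k%:R :> R by lra.
have k9 : (9 < k)%N by rewrite -(ltr_nat R).
have yb : y <= b%:R.
  by rewrite -(ler_pM2r l0) yl; nra.
have k2R : (k - 2)%:R = k%:R - 2 :> R by rewrite natrB // (leq_trans _ k9).
have k3R : (k - 3)%:R = k%:R - 3 :> R by rewrite natrB // (leq_trans _ k9).
have k1R : (k - 1)%:R = k%:R - 1 :> R by rewrite natrB // (leq_trans _ k9).
have k2_gt0 : 0 < k%:R - 2 :> R by lra.
have by_ : b%:R = l / C * y by rewrite /y; field; rewrite C_neq0 gt_eqF.
(* The ratio is at most [k exp (- b / (k - 2))], and [b / (k - 2) >= l] because [k - 2 <= y] and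
   [b = (l / C) y]; so it is at most [k / b]. *)
have few : (k * (k - 3) ^ b <= (k - 2) ^ b)%N.
  rewrite -(ler_nat R) natrM !natrX k3R k2R.
  have -> : k%:R - 3 = (1 - (k%:R - 2)^-1) * (k%:R - 2) :> R.
    by field; rewrite gt_eqF.
  rewrite exprMn mulrA ler_piMl ?exprn_ge0 ?(ltW k2_gt0) //.
  apply: le_trans (_ : k%:R * b%:R^-1 <= 1 :> R); last first.
    by rewrite ler_pdivrMr // mul1r; lra.
  rewrite ler_wpM2l // -eb -expRN.
  apply: le_trans (pow1B_le_expR _ _) _; first by rewrite invf_le1 //; lra.
  rewrite ler_expR lerN2 ler_pdivlMr //.
  apply: le_trans (_ : l * y <= _); first by rewrite ler_pM2l //; lra.
  by rewrite by_ ler_pM2r //; lra.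
split=> //; [exact: leq_trans _ k9 | by rewrite -(ler_nat R); lra |].
set B := _ `^ _.
have BE : B = expR (l / C) by rewrite /B /powR gt_eqF // mulrC.
have b_le_B : b%:R <= B by rewrite BE -eb ler_expR.
(* This bounds [1 / q], which is at most [exp (b / (k - 2))]. Passing from [y] to [k - 2] raises the
   exponent [l / C] by at most 1, hence the factor [e <= 4]. *)
have ratio : ((k - 1) ^ b)%:R <= 4 * B * ((k - 2) ^ b)%:R.
  rewrite !natrX k1R k2R.
  have -> : k%:R - 1 = (1 + (k%:R - 2)^-1) * (k%:R - 2) :> R.
    by field; rewrite gt_eqF.
  rewrite exprMn ler_wpM2r ?exprn_ge0 ?(ltW k2_gt0) //.
  apply: le_trans (_ : expR (b%:R * (k%:R - 2)^-1) <= _).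
    rewrite expRM_natl lerXn2r ?nnegrE ?expR_ge0 ?expR_ge1Dx //.
    by rewrite addr_ge0 // invr_ge0 ltW.
  apply: le_trans (_ : expR (1 + l / C) <= _).
    rewrite ler_expR ler_pdivrMr // by_.
    have lC0 : 0 < l / C by rewrite divr_gt0.
    move: y_ge; set z := l / C in lC0 *; nra.
  by rewrite expRD BE ler_wpM2r ?expR_ge0 // expR1_le4.
have rate_inv : (root_rate R b k)^-1 <= 24 * l * B / (C * b%:R).
  have k2b_gt0 : 0 < ((k - 2) ^ b)%:R :> R by rewrite ltr0n expn_gt0 subn_gt0 (leq_trans _ k9).
  rewrite /root_rate invfM invrK.
  apply: le_trans (_ : (k%:R * ((k - 2) ^ b)%:R)^-1 * (3 * (4 * B * ((k - 2) ^ b)%:R)) <= _).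
    by rewrite ler_wpM2l ?invr_ge0 ?mulr_ge0 // ler_pM2l.
  have -> : (k%:R * ((k - 2) ^ b)%:R)^-1 * (3 * (4 * B * ((k - 2) ^ b)%:R)) = 12 * B * k%:R^-1 :> R.
    by field; rewrite !gt_eqF //; lra.
  have -> : 24 * l * B / (C * b%:R) = 12 * B * (2 / y).
    by rewrite /y; field; rewrite C_neq0 !gt_eqF.
  rewrite ler_wpM2l ?mulr_ge0 ?powR_ge0 //.
  have [y0 k0] : 0 < y /\ 0 < k%:R :> R by split; lra.
  by rewrite ler_pdivlMr // [leLHS]mulrC ler_pdivrMr //; lra.
have B0 : 0 < B by rewrite BE expR_gt0.
have b1 : 1 <= b%:R :> R by rewrite ler1n.
rewrite /relax_bound.
(* Here [b + 1 <= 2 b], and 24 is [3 * 4 * 2], the last 2 coming from [k >= y / 2]; then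
   [192 = 4 * 24 * 2]. *)
apply: le_trans (_ : (2 + 4 * (24 * l * B / (C * b%:R))) * (2 * b%:R) <= _).
  apply: ler_pM; rewrite ?addr_ge0 ?mulr_ge0 ?invr_ge0 ?root_rate_ge0 //.
  - rewrite /root_rate divr_ge0 ?mulr_ge0 //.
  - by rewrite lerD2l ler_pM2l.
  - by rewrite -(natr1 b); lra.
have -> : (2 + 4 * (24 * l * B / (C * b%:R))) * (2 * b%:R) = 4 * b%:R + 192 / C * B * l.
  by field; rewrite C_neq0 gt_eqF.
have : b%:R <= B * l by nra.
have -> : (4 + 192 / C) * B * l = 4 * (B * l) + 192 / C * B * l by ring.
lra.
Qed.

(** Both regimes of [C] are handled at once. The facts [1 <= ln b] and [0 <= c] are returned so that
    powers of the logarithm can be raised afterwards. *)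
Lemma star_bounds (C : R) : 0 < C -> C <= 1 ->
  exists c : R, exists b0 : nat, forall b k : nat, (b0 < b)%N ->
    k%:R <= C * b%:R / ln (b%:R : R) < k%:R + 1 ->
    [/\ 1 <= ln (b%:R : R), 0 <= c,
     (tmix (glauber R b k) <= (c * (b%:R `^ C^-1) * ln (b%:R : R) ^+ 2)%:E)%E &
     (trel (glauber R b k) <= (c * (b%:R `^ C^-1) * ln (b%:R : R))%:E)%E].
Proof.
move=> C0 C1; pose M := 60 / C + 36 / C ^+ 2.
exists (10 + 192 / C), (Num.trunc (expR M)) => b k bb0 hk.
have C36 : 36 <= 36 / C ^+ 2.
  by rewrite ler_pdivlMr ?exprn_gt0 // ler_piMr // exprn_ile1 // ltW.
have C60 : 60 <= 60 / C by rewrite ler_pdivlMr // ler_piMr.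
have M_le : M <= ln (b%:R : R).
  rewrite -(expRK M) ler_ln ?posrE ?expR_gt0 ?ltr0n //; last by case: b bb0 {hk}.
  apply: ltW; apply: lt_le_trans (truncnS_gt _) _; by rewrite ler_nat.
have [||k2 kb few relax_le] := star_regime C0 C1 _ _ hk; [rewrite /M in M_le; lra..|].
set l := ln _ in M_le relax_le *.
have l64 : 64 <= l by rewrite /M in M_le; lra.
set B := _ `^ _ in relax_le *.
have b_gt0 : (0 < b)%N by case: b bb0 @l @B {hk kb few relax_le M_le l64}.
have bR : 0 < b%:R :> R by rewrite ltr0n.
have eb : expR l = b%:R by rewrite lnK.
have b_ge64 : 64 <= b%:R :> R by rewrite -eb; have := expR_ge1Dx l; lra.
have b_le_B : b%:R <= B.
  by rewrite /B /powR gt_eqF // -[leLHS]eb ler_expR ler_pdivlMl // ler_piMl //; lra.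
have c0 : 0 <= 192 / C by rewrite divr_ge0 // ltW.
have B0 : 0 < B by lra.
set T := relax_bound R b k in relax_le.
have T1 : 1 < T := relax_bound_gt1 R b k2.
have T_gt0 : 0 < T by apply: lt_trans T1.
have T_inv : T^-1 <= 1 by rewrite invf_le1 // ltW.
(* Burn-in of about [2 (b + 1) ln b] steps, then [T ln b] steps with [T] the relaxation bound; the
   successors round up. *)
pose L := (Num.trunc (2 * b.+1%:R * l)).+1; pose t := (Num.trunc (T * l)).+1.
have arg_ge0 : 0 <= 2 * b.+1%:R * l by rewrite mulr_ge0 //; lra.
have Tl_ge0 : 0 <= T * l by rewrite mulr_ge0 //; lra.
have L_gt : 2 * b.+1%:R * l < L%:R by apply: truncnS_gt.
have t_gt : T * l < t%:R by apply: truncnS_gt.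
have L_le : L%:R <= 2 * b.+1%:R * l + 1.
  by rewrite /L -(natr1 (Num.trunc _)) lerD2r; case/andP: (truncn_itv arg_ge0).
have t_le : t%:R <= T * l + 1.
  by rewrite /t -(natr1 (Num.trunc _)) lerD2r; case/andP: (truncn_itv Tl_ge0).
have Bl : B * l ^+ 2 >= B * l by rewrite expr2 mulrA ler_peMr ?mulr_ge0 //; lra.
have BlB : B <= B * l by rewrite ler_peMr //; lra.
have mixed : mixed_at (glauber R b k) (t + L).
  (* The error [s + 2 eps] is [1/8 + 2/b <= 1/4 <= 1/e]. Contraction needs
     [k / b^2 <= 1 / b <= 1/64], whence the use of [b >= 64]. *)
  apply: (@star_mixed _ _ _ k2 few L t (b%:R^-1) (8^-1)) => //.
  - have -> : b%:R / b.+1%:R = 1 - b.+1%:R^-1 :> R.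
      by rewrite -(natr1 b); field; rewrite natr1 pnatr_eq0.
    apply: le_trans (_ : b%:R * expR (- (2 * l)) <= _).
      rewrite ler_pM2l //; apply: le_trans (pow1B_le_expR _ _) _.
        by rewrite invf_le1 ?ler1n.
      rewrite ler_expR lerN2 ler_pdivlMr //; lra.
    rewrite expRN expRM_natl eb expr2 invfM mulrA mulfV ?gt_eqF // mul1r //.
  - have lamt : (1 - T^-1) ^+ t <= b%:R^-1.
      apply: le_trans (pow1B_le_expR _ T_inv) _.
      rewrite -eb -expRN ler_expR lerN2 ler_pdivlMr; lra.
    have lamt0 : 0 <= (1 - T^-1) ^+ t.
      by rewrite exprn_ge0 // subr_ge0.
    apply: le_trans (_ : b%:R^-1 ^+ 2 * b%:R <= _).
      by apply: ler_pM; rewrite ?sqr_ge0 // ?ler_nat // lerXn2r ?nnegrE // invr_ge0 ltW.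
    rewrite expr2 -mulrA mulVf ?gt_eqF // mulr1 -(ler_pM2r bR) mulVf ?gt_eqF //.
    by rewrite expr2; move: b_ge64; clear; lra.
  - apply: le_trans (_ : 4^-1 <= _).
      have : b%:R^-1 <= 16^-1 :> R by rewrite lef_pV2 ?posrE //; lra.
      lra.
    by rewrite lef_pV2 ?posrE ?expR_gt0 ?expR1_le4.
split; [lra | lra | |].
  apply: le_trans (ereal_inf_lbound _) _.
    by exists (t + L)%N; [exact: mixed | reflexivity].
  rewrite lee_fin natrD -natr1 in L_le *.
  have : T * l <= (4 + 192 / C) * (B * l ^+ 2).
    rewrite expr2 [_ * (l * l)]mulrA [leRHS]mulrA ler_pM2r; last lra.
    by rewrite mulrA.
  have : b%:R * l <= B * l by rewrite ler_pM2r; lra.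
  have -> : (10 + 192 / C) * B * l ^+ 2 = (4 + 192 / C) * (B * l ^+ 2) + 6 * (B * l ^+ 2) by ring.
  have := c0; move: (192 / C) => D hD; nra.
apply: le_trans (star_trel R k2 few) _; rewrite lee_fin; apply: le_trans relax_le _.
by rewrite -!mulrA ler_pM2r ?mulr_gt0 //; lra.
Qed.

End Estimates.

Theorem theorem4 (R : realType) :
  (forall C : R, 0 < C -> C < 1 ->
    exists c : R, exists b0 : nat, forall b k : nat, (b0 < b)%N ->
      k%:R <= C * b%:R / ln (b%:R : R) < k%:R + 1 ->
      (tmix (glauber R b k) <= (c * (b%:R `^ C^-1) * ln (b%:R : R) ^+ 2)%:E)%E /\
      (trel (glauber R b k) <= (c * (b%:R `^ C^-1) * ln (b%:R : R) ^+ 2)%:E)%E) /\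
  (exists c : R, exists b0 : nat, forall b k : nat, (b0 < b)%N ->
      k%:R <= b%:R / ln (b%:R : R) < k%:R + 1 ->
      (tmix (glauber R b k) <= (c * b%:R * ln (b%:R : R) ^+ 4)%:E)%E /\
      (trel (glauber R b k) <= (c * b%:R * ln (b%:R : R) ^+ 4)%:E)%E).
Proof.
split=> [C C0 C1|].
  have [c [b0 h]] := star_bounds C0 (ltW C1).
  exists c, b0 => b k bb0 hk; have [l1 c0 mix rel] := h b k bb0 hk; split=> //.
  apply: le_trans rel _; rewrite lee_fin ler_wpM2l ?mulr_ge0 ?powR_ge0 //.
  by rewrite expr2 ler_peMr //; lra.
(* At [C = 1] the power [b^(1/C)] is [b], and [ln b >= 1] lets the logarithm be raised to the fourth
   power. *)
have [c [b0 h]] := star_bounds (@ltr01 R) (lexx _).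
exists c, b0 => b k bb0 hk; have := h b k bb0.
rewrite mul1r invr1 powRr1 // => /(_ hk)[l1 c0 mix rel].
have cb : 0 <= c * b%:R by rewrite mulr_ge0.
split; [apply: le_trans mix _ | apply: le_trans rel _]; rewrite lee_fin ler_wpM2l //.
  exact: ler_weXn2l.
exact: (ler_weXn2l l1 (isT : (1 <= 4)%N)).
Qed.
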